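(* There exist universal constants $c>0$ and $C>0$ such that the following holds. Let $\pi=(L_x,L_y,L_{xy},\mu_x,\mu_y,\mu_{xy},\mu_{yx})$ be an admissible parameter vector satisfying $$L_x>4\mu_x,\quad L_y>4\mu_y,\quad L_{xy}>18\max\{\mu_{xy},\mu_{yx},\sqrt{\mu_x\mu_y}\},\quad \sqrt{L_xL_y}>4\max\{\mu_{xy},\mu_{yx}\},$$ and $\min\{\delta_x,\delta_y\}>0$, where $\delta_x=\mu_x+\mu_{xy}^2/L_y$ and $\delta_y=\mu_y+\mu_{yx}^2/L_x$. Let $R>0$, $\epsilon>0$ and computation times $\tau_f,\tau_g,\tau_{\mathbf B}>0$ be arbitrary. Then there exists a $\pi$-regular saddle-point problem $\min_{x\in\mathcal X}\max_{y\in\mathcal Y} f(x)+\langle y,\mathbf Bx\rangle-g(y)$ (for some finite dimensions $d_x,d_y$) such that $\mathcal R^2_{\delta_x\delta_y}(0,0)=R^2$ and, for every first-order saddle-point optimization method with times $\tau_f,\tau_g,\tau_{\mathbf B}$ applied to this problem and every execution time $\tau\ge0$, if $\mathcal R^2_{\delta_x\delta_y}(x_o(\tau),y_o(\tau))<\epsilon$, then $$\tau\ \ge\ C\left(\tau_f\sqrt{\kappa_x}\log\frac{cR^2}{\epsilon}+\tau_g\sqrt{\kappa_y}\log\frac{cR^2}{\epsilon}+\tau_{\mathbf B}\sqrt{\kappa_{xy}}\log\frac{cR^2}{\epsilon}\right),$$ where $\kappa_x=L_x/\delta_x$, $\kappa_y=L_y/\delta_y$, $\kappa_{xy}=L_{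xy}^2/(\delta_x\delta_y)$.
   Context: **Problem.** $\mathcal X=\mathbb R^{d_x}$, $\mathcal Y=\mathbb R^{d_y}$, $\mathbf B\in\mathbb R^{d_y\times d_x}$, and $f:\mathcal X\to\mathbb R$, $g:\mathcal Y\to\mathbb R$ are differentiable convex functions. The problem is $\min_{x\in\mathcal X}\max_{y\in\mathcal Y} f(x)+\langle y,\mathbf Bx\rangle-g(y)$. For a differentiable $h$, $\mathrm D_h(x,x')=h(x)-h(x')-\langle\nabla h(x'),x-x'\rangle$. A differentiable function $h$ is $\mu$-strongly convex ($\mu\ge0$) if $\mathrm D_h(x,x')\ge\frac{\mu}{2}\|x-x'\|^2$ for all $x,x'$ (convex if $\mu=0$), and a differentiable convex $h$ is $L$-smooth if $|\mathrm D_h(x,x')|\le\frac L2\|x-x'\|^2$ for all $x,x'$. **Parameters.** $\pi=(L_x,L_y,L_{xy},\mu_x,\mu_y,\mu_{xy},\mu_{yx})\in\mathbb R_+^7$ is admissible if $L_x>\mu_x\ge0$, $L_y>\mu_y\ge0$, $L_{xy}>\mu_{xy}\ge0$, $L_{xy}>\mu_{yx}\ge0$, and $\mu_{xy}=\mu_{yx}$ whenever both $\mu_{xy}>0$ and $\mu_{yx}>0$. The problem is $\pi$-regular if: - $f$ is $\mu_x$-strongly convex and $L_x$-smooth; $g$ is $\mu_y$-strongly convex and $L_y$-smooth; - $\mu_{xy}^2\le\lambda_{\min}^+(\mathbf B^\top\mathbf B)$ if $\nabla f(x)\in\mathrm{range}\,\mathbf B^\top$ for all $x\in\mathcal X$,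 and $\mu_{xy}^2\le\lambda_{\min}(\mathbf B^\top\mathbf B)$ otherwise; - $\mu_{yx}^2\le\lambda_{\min}^+(\mathbf B\mathbf B^\top)$ if $\nabla g(y)\in\mathrm{range}\,\mathbf B$ for all $y\in\mathcal Y$, and $\mu_{yx}^2\le\lambda_{\min}(\mathbf B\mathbf B^\top)$ otherwise; - $L_{xy}^2\ge\lambda_{\max}(\mathbf B^\top\mathbf B)$. Here $\lambda_{\min},\lambda_{\min}^+,\lambda_{\max}$ are the smallest, smallest positive and largest eigenvalues. **Solutions and distance.** With $P(x)=f(x)+g^*(\mathbf Bx)$, $D(y)=-g(y)-f^*(-\mathbf B^\top y)$ ($h^*$ is the Fenchel conjugate), let $\mathcal S_x=\mathrm{Argmin}_{x\in\mathcal X}P(x)$, $\mathcal S_y=\mathrm{Argmax}_{y\in\mathcal Y}D(y)$ (these are nonempty affine subspaces when $\min\{\delta_x,\delta_y\}>0$). With $\mathrm{dist}(x;\mathcal A)=\min_{x'\in\mathcal A}\|x-x'\|$, $$\mathcal R^2_{\delta_x\delta_y}(x,y)=\delta_x\,\mathrm{dist}^2(x;\mathcal S_x)+\delta_y\,\mathrm{dist}^2(y;\mathcal S_y).$$ **First-order saddle-point optimization method** with gradient times $\tau_f,\tau_g>0$ and matrix-vector time $\tau_{\mathbf B}>0$: at every time $\tau\ge0$ the algorithm maintains a memory $\mathcal M(\tau)=\mathcal M_x(\tau)\times\mathcal M_y(\tau)$, $\mathcal M_x(\tau)\subset\mathcal X$, $\mathcal M_y(\tau)\subset\mathcal Y$,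 with $\mathcal M_x(0)=\{0\}$, $\mathcal M_y(0)=\{0\}$, and $$\mathcal M_x(\tau)\subset\mathcal M_f(\tau)\cup\mathcal M_{\mathbf B^\top}(\tau),\qquad \mathcal M_y(\tau)\subset\mathcal M_g(\tau)\cup\mathcal M_{\mathbf B}(\tau),$$ where $\mathcal M_f(\tau)=\mathrm{span}(\{x,\nabla f(x):x\in\mathcal M_x(\tau-\tau_f)\})$ if $\tau\ge\tau_f$ and $\{0\}$ otherwise; $\mathcal M_g(\tau)=\mathrm{span}(\{y,\nabla g(y):y\in\mathcal M_y(\tau-\tau_g)\})$ if $\tau\ge\tau_g$ and $\{0\}$ otherwise; $\mathcal M_{\mathbf B^\top}(\tau)=\mathrm{span}(\{x,\mathbf B^\top y:(x,y)\in\mathcal M(\tau-\tau_{\mathbf B})\})$ if $\tau\ge\tau_{\mathbf B}$ and $\{0\}$ otherwise; $\mathcal M_{\mathbf B}(\tau)=\mathrm{span}(\{\mathbf Bx,y:(x,y)\in\mathcal M(\tau-\tau_{\mathbf B})\})$ if $\tau\ge\tau_{\mathbf B}$ and $\{0\}$ otherwise. At every time $\tau\ge0$ the algorithm specifies an output $(x_o(\tau),y_o(\tau))\in\mathcal M(\tau)$. *)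

(* Defs.v *)
From HB Require Import structures.
From mathcomp Require Import all_boot all_order all_algebra.
From mathcomp Require Import all_classical all_reals all_analysis.
Import Order.TTheory GRing.Theory Num.Theory.
Import numFieldNormedType.Exports.

Set Implicit Arguments.
Unset Strict Implicit.
Unset Printing Implicit Defensive.

Local Open Scope classical_set_scope.
Local Open Scope ring_scope.

(* Vectors of R^n are columns 'cV[R]_n.  The norm `|x| that the library puts on
   matrices is the sup norm: it is only used, through [differentiable], for its
   topology.  All metric quantities below use the Euclidean norm [enorm]. *)

Definition dot (R : realType) (n : nat) (u v : 'cV[R]_n) : R :=
  (u^T *m v) 0 0.

Definition enorm (R : realType) (n : nat) (u : 'cV[R]_n) : R :=
  Num.sqrt (dot u u).

Definition grad (R : realType) (n : nat) (h : 'cV[R]_n -> R) (x : 'cV[R]_n) :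
  'cV[R]_n := \col_i 'D_(delta_mx i 0) h x.

Definition bregman (R : realType) (n : nat) (h : 'cV[R]_n -> R)
    (x x' : 'cV[R]_n) : R :=
  h x - h x' - dot (grad h x') (x - x').

Definition strongly_convex (R : realType) (n : nat) (mu : R)
    (h : 'cV[R]_n -> R) : Prop :=
  (forall x, differentiable h x) /\
  (forall x x', mu / 2 * enorm (x - x') ^+ 2 <= bregman h x x').

Definition smooth (R : realType) (n : nat) (L : R) (h : 'cV[R]_n -> R) : Prop :=
  strongly_convex 0 h /\
  (forall x x', `|bregman h x x'| <= L / 2 * enorm (x - x') ^+ 2).

(* The three notions below are meant for symmetric matrices of positive size,
   whose eigenvalues form a nonempty finite set: there [inf] and [sup] are a
   minimum and a maximum.  If there is no positive eigenvalue, then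
   [lambda_min_pos A = inf set0 = 0], so that mu ^+ 2 <= lambda_min_pos A
   forces mu = 0. *)
Definition lambda_min (R : realType) (n : nat) (A : 'M[R]_n) : R :=
  inf [set l : R | eigenvalue A l].

Definition lambda_min_pos (R : realType) (n : nat) (A : 'M[R]_n) : R :=
  inf [set l : R | eigenvalue A l /\ 0 < l].

Definition lambda_max (R : realType) (n : nat) (A : 'M[R]_n) : R :=
  sup [set l : R | eigenvalue A l].

Record params (R : realType) := Params {
  Lx : R; Ly : R; Lxy : R; mux : R; muy : R; muxy : R; muyx : R }.

Definition admissible (R : realType) (p : params R) : Prop :=
  [/\ 0 <= mux p < Lx p,
      0 <= muy p < Ly p,
      0 <= muxy p < Lxy p,
      0 <= muyx p < Lxy p &
      0 < muxy p -> 0 < muyx p -> muxy p = muyx p].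

Definition deltax (R : realType) (p : params R) : R :=
  mux p + muxy p ^+ 2 / Ly p.

Definition deltay (R : realType) (p : params R) : R :=
  muy p + muyx p ^+ 2 / Lx p.

Definition kappax (R : realType) (p : params R) : R := Lx p / deltax p.

Definition kappay (R : realType) (p : params R) : R := Ly p / deltay p.

Definition kappaxy (R : realType) (p : params R) : R :=
  Lxy p ^+ 2 / (deltax p * deltay p).

Definition grad_in_range (R : realType) (n m : nat) (h : 'cV[R]_n -> R)
    (A : 'M[R]_(n, m)) : Prop :=
  forall x, exists y : 'cV[R]_m, grad h x = A *m y.

Definition regular (R : realType) (p : params R) (dx dy : nat)
    (f : 'cV[R]_dx -> R) (g : 'cV[R]_dy -> R) (B : 'M[R]_(dy, dx)) : Prop :=
  (strongly_convex (mux p) f /\ smooth (Lx p) f) /\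
  (strongly_convex (muy p) g /\ smooth (Ly p) g) /\
  ((grad_in_range f B^T -> muxy p ^+ 2 <= lambda_min_pos (B^T *m B)) /\
   (~ grad_in_range f B^T -> muxy p ^+ 2 <= lambda_min (B^T *m B))) /\
  ((grad_in_range g B -> muyx p ^+ 2 <= lambda_min_pos (B *m B^T)) /\
   (~ grad_in_range g B -> muyx p ^+ 2 <= lambda_min (B *m B^T))) /\
  lambda_max (B^T *m B) <= Lxy p ^+ 2.

Section primal_dual.
Local Open Scope ereal_scope.

Definition fenchel (R : realType) (n : nat) (h : 'cV[R]_n -> R)
    (z : 'cV[R]_n) : \bar R :=
  ereal_sup [set (dot z x - h x)%:E | x in [set: 'cV[R]_n]].

Definition primal (R : realType) (dx dy : nat) (f : 'cV[R]_dx -> R)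
    (g : 'cV[R]_dy -> R) (B : 'M[R]_(dy, dx)) (x : 'cV[R]_dx) : \bar R :=
  (f x)%:E + fenchel g (B *m x)%R.

Definition dual (R : realType) (dx dy : nat) (f : 'cV[R]_dx -> R)
    (g : 'cV[R]_dy -> R) (B : 'M[R]_(dy, dx)) (y : 'cV[R]_dy) : \bar R :=
  - (g y)%:E - fenchel f (- (B^T *m y))%R.

Definition primal_sol (R : realType) (dx dy : nat) (f : 'cV[R]_dx -> R)
    (g : 'cV[R]_dy -> R) (B : 'M[R]_(dy, dx)) : set 'cV[R]_dx :=
  [set x | forall x', primal f g B x <= primal f g B x'].

Definition dual_sol (R : realType) (dx dy : nat) (f : 'cV[R]_dx -> R)
    (g : 'cV[R]_dy -> R) (B : 'M[R]_(dy, dx)) : set 'cV[R]_dy :=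
  [set y | forall y', dual f g B y' <= dual f g B y].

(* Extended-real valued, so that the distance to the empty set is +oo. *)
Definition dist (R : realType) (n : nat) (x : 'cV[R]_n) (A : set 'cV[R]_n) :
  \bar R := ereal_inf [set (enorm (x - x')%R)%:E | x' in A].

Definition R2 (R : realType) (p : params R) (dx dy : nat) (f : 'cV[R]_dx -> R)
    (g : 'cV[R]_dy -> R) (B : 'M[R]_(dy, dx))
    (x : 'cV[R]_dx) (y : 'cV[R]_dy) : \bar R :=
  (deltax p)%:E * dist x (primal_sol f g B) ^+ 2 +
  (deltay p)%:E * dist y (dual_sol f g B) ^+ 2.

End primal_dual.

Definition lin_span (R : realType) (n : nat) (A : set 'cV[R]_n) :
  set 'cV[R]_n :=
  [set v | exists2 s : seq 'cV[R]_n, {in s, forall u, A u} & v \in << s >>%VS].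

Section memory.
Variables (R : realType) (dx dy : nat).
Variables (f : 'cV[R]_dx -> R) (g : 'cV[R]_dy -> R) (B : 'M[R]_(dy, dx)).
Variables (tf tg tB : R) (Mx : R -> set 'cV[R]_dx) (My : R -> set 'cV[R]_dy).

Definition mem_f (t : R) : set 'cV[R]_dx :=
  if tf <= t then
    lin_span [set u | exists2 x, Mx (t - tf) x & u = x \/ u = grad f x]
  else [set 0].

Definition mem_g (t : R) : set 'cV[R]_dy :=
  if tg <= t then
    lin_span [set u | exists2 y, My (t - tg) y & u = y \/ u = grad g y]
  else [set 0].

Definition mem_Bt (t : R) : set 'cV[R]_dx :=
  if tB <= t then
    lin_span [set u | exists2 z, (Mx (t - tB) `*` My (t - tB)) z &
                      u = z.1 \/ u = B^T *m z.2]
  else [set 0].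

Definition mem_B (t : R) : set 'cV[R]_dy :=
  if tB <= t then
    lin_span [set u | exists2 z, (Mx (t - tB) `*` My (t - tB)) z &
                      u = B *m z.1 \/ u = z.2]
  else [set 0].

(* The values of Mx, My, xo and yo at negative times are irrelevant. *)
Definition first_order_method (xo : R -> 'cV[R]_dx) (yo : R -> 'cV[R]_dy) :
    Prop :=
  [/\ Mx 0 = [set 0],
      My 0 = [set 0],
      forall t, 0 <= t -> Mx t `<=` mem_f t `|` mem_Bt t,
      forall t, 0 <= t -> My t `<=` mem_g t `|` mem_B t &
      forall t, 0 <= t -> Mx t (xo t) /\ My t (yo t)].

End memory.

(* Main.v *)
Require Import Defs.
From mathcomp Require Import all_boot all_order all_algebra.
From mathcomp Require Import all_classical all_reals all_analysis.
From mathcomp Require Import ring lra zify.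
Import Order.TTheory GRing.Theory Num.Theory.
Import numFieldNormedType.Exports.

(* It suffices to find, for each of the three oracles separately, a problem
   that needs many calls to that oracle: the largest of the three terms is at
   least a third of their sum.  All problems are quadratic.  Their coordinates
   form one or two copies of a path on which the counted oracle moves
   information by one step and the two others do not move it at all.  The
   linear terms are chosen so that the saddle point is a geometric sequence
   q^i along the path.  The homogeneous stationarity equations hold for it at
   the interior vertices, so the linear terms live at the two ends, and after
   k calls the middle part of the path is still unexplored, which leaves an
   error of order q^(2k).

   For the gradient of f, the Hessian of f is a path Laplacian and B is a
   multiple of the identity (or of a coordinate projection if muxy = 0), so the
   primal function has curvature between deltax and O(Lx).  The gradient of g
   follows by exchanging the players.  For the products with B, when
   muxy = muyx = mu > 0, one needs B to have singular values at least mu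
   although the condition number involves the much smaller product
   deltax deltay: with a path difference K of norm O(Lxy), soft variables x1, y2
   (curvature mux, muy) and stiff ones x2, y1 (curvature Lx, Ly), the matrix
   B = [mu, -K^T; K, mu] satisfies B^T B = mu^2 + diag(K^T K, K K^T), while
   eliminating x2 and y1 leaves the soft variables with curvatures close to
   deltax and deltay. *)

Set Implicit Arguments.
Unset Strict Implicit.
Unset Printing Implicit Defensive.

Local Open Scope classical_set_scope.
Local Open Scope ring_scope.

(** * Quadratic forms *)

Section dot.
Variable R : realType.
Implicit Types n m : nat.

Lemma dotE n (u v : 'cV[R]_n) : dot u v = \sum_i u i 0 * v i 0.
Proof. by rewrite /dot mxE; apply: eq_bigr => i _; rewrite mxE. Qed.

Lemma dotC n (u v : 'cV[R]_n) : dot u v = dot v u.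
Proof. by rewrite !dotE; apply: eq_bigr => i _; rewrite mulrC. Qed.

Lemma dotDr n (u v w : 'cV[R]_n) : dot u (v + w) = dot u v + dot u w.
Proof. by rewrite /dot mulmxDr mxE. Qed.

Lemma dotDl n (u v w : 'cV[R]_n) : dot (v + w) u = dot v u + dot w u.
Proof. by rewrite dotC dotDr !(dotC u). Qed.

Lemma dotZr n a (u v : 'cV[R]_n) : dot u (a *: v) = a * dot u v.
Proof. by rewrite /dot -scalemxAr mxE. Qed.

Lemma dotZl n a (u v : 'cV[R]_n) : dot (a *: u) v = a * dot u v.
Proof. by rewrite dotC dotZr dotC. Qed.

Lemma dotNr n (u v : 'cV[R]_n) : dot u (- v) = - dot u v.
Proof. by rewrite -scaleN1r dotZr mulN1r. Qed.

Lemma dotNl n (u v : 'cV[R]_n) : dot (- u) v = - dot u v.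
Proof. by rewrite dotC dotNr dotC. Qed.

Lemma dotBr n (u v w : 'cV[R]_n) : dot u (v - w) = dot u v - dot u w.
Proof. by rewrite dotDr dotNr. Qed.

Lemma dotBl n (u v w : 'cV[R]_n) : dot (v - w) u = dot v u - dot w u.
Proof. by rewrite dotDl dotNl. Qed.

Lemma dot0r n (u : 'cV[R]_n) : dot u 0 = 0.
Proof. by rewrite /dot mulmx0 mxE. Qed.

Lemma dot0l n (u : 'cV[R]_n) : dot 0 u = 0.
Proof. by rewrite dotC dot0r. Qed.

Lemma dot_tr n m (M : 'M[R]_(n, m)) u v : dot u (M *m v) = dot (M^T *m u) v.
Proof. by rewrite /dot trmx_mul trmxK mulmxA. Qed.

Lemma dot_delta n (i : 'I_n) (u : 'cV[R]_n) : dot u (delta_mx i 0) = u i 0.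
Proof.
rewrite dotE (bigD1 i) //= mxE !eqxx mulr1 big1 ?addr0 // => j /negPf ji.
by rewrite mxE ji mulr0.
Qed.

Lemma dot_ge0 n (u : 'cV[R]_n) : 0 <= dot u u.
Proof. by rewrite dotE sumr_ge0 // => i _; rewrite -expr2 sqr_ge0. Qed.

Lemma dot_eq0 n (u : 'cV[R]_n) : (dot u u == 0) = (u == 0).
Proof.
apply/eqP/eqP => [|->]; last exact: dot0r.
rewrite dotE => /psumr_eq0P u0; apply/colP => i; rewrite mxE.
by apply/eqP; rewrite -sqrf_eq0 expr2 u0 // => j _; rewrite -expr2 sqr_ge0.
Qed.

Lemma enorm_sqr n (u : 'cV[R]_n) : enorm u ^+ 2 = dot u u.
Proof. by rewrite sqr_sqrtr // dot_ge0. Qed.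

Lemma dot_col_mx n m (u1 v1 : 'cV[R]_n) (u2 v2 : 'cV[R]_m) :
  dot (col_mx u1 u2) (col_mx v1 v2) = dot u1 v1 + dot u2 v2.
Proof. by rewrite /dot tr_col_mx mul_row_col mxE. Qed.

Lemma mulmx_tr_bound n m (M : 'M[R]_(n, m)) L : 0 < L ->
  (forall u, dot (M *m u) (M *m u) <= L * dot u u) ->
  forall v, dot (M^T *m v) (M^T *m v) <= L * dot v v.
Proof.
move=> L0 ML v; set w := M^T *m v.
(* Expand [|M w - L v|^2 >= 0]. *)
have := dot_ge0 (M *m w - L *: v); rewrite dotBl !dotBr !dotZl !dotZr.
have e : dot (M *m w) v = dot w w by rewrite dotC dot_tr.
rewrite (dotC v) e => h; have := ML w => {}ML.
by rewrite -(ler_pM2l L0); lra.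
Qed.

End dot.

Section quadratic.
Variables (R : realType) (n : nat) (A : 'M[R]_n) (b : 'cV[R]_n).
Hypothesis A_sym : A^T = A.

Definition quad (x : 'cV[R]_n) : R := dot x (A *m x) / 2 - dot b x.

Lemma quadD x u :
  quad (x + u) = quad x + dot (A *m x - b) u + dot u (A *m u) / 2.
Proof.
rewrite /quad mulmxDr !(dotDl, dotDr, dotNl).
have -> : dot x (A *m u) = dot (A *m x) u by rewrite dot_tr A_sym.
rewrite (dotC u (A *m x)); lra.
Qed.

Lemma derive_quad x v : 'D_v quad x = dot (A *m x - b) v.
Proof.
apply: cvg_lim => //.
set a := dot _ _; set c := dot v (A *m v) / 2.
(* The difference quotient of a quadratic at t is exactly a + t c; the limit is written as the value
   of this expression at t = 0. *)
have -> : a = a + 0 * c by rewrite mul0r addr0.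
have lc : (a + t * c) @[t --> (0 : R)^'] --> a + 0 * c.
  apply: cvg_trans (cvg_app _ (@nbhs_dnbhs _ (0 : R))) _.
  apply: cvgD; first exact: cvg_cst.
  by apply: cvgM; [exact: cvg_id | exact: cvg_cst].
apply: cvg_trans lc; apply: near_eq_cvg; near=> t.
have t0 : t != 0 by near: t; exact: nbhs_dnbhs_neq.
rewrite /= /shift /= [t *: v + x]addrC quadD.
rewrite -scalemxAr dotZr dotZl dotZr.
rewrite -/a /GRing.scale /= /c. field.
Unshelve. all: by end_near. Qed.

Lemma grad_quad x : grad quad x = A *m x - b.
Proof. by apply/colP => i; rewrite mxE derive_quad dot_delta. Qed.

Lemma bregman_quad x x' :
  bregman quad x x' = dot (x - x') (A *m (x - x')) / 2.
Proof. by rewrite /bregman grad_quad -{1}[x](subrKC x') quadD; ring. Qed.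

Lemma differentiable_quad x : differentiable quad x.
Proof.
have dE (c : 'cV[R]_n) : differentiable (dot c) x.
  have -> : dot c = \sum_(i < n) (fun x : 'cV[R]_n => c i 0 * x i 0).
    by apply/funext => y; rewrite dotE fct_sumE.
  apply: differentiable_sum => i.
  by apply: differentiableM; [exact: differentiable_cst|exact: differentiable_coord].
have -> : quad = (\sum_(i < n) ((fun x : 'cV[R]_n => x i 0) * (fun x => dot (row i A)^T x))) * cst (2^-1) - dot b.
  apply/funext => y; rewrite /quad dotE /= !fctE fct_sumE; congr (_ / _ - _).
  apply: eq_bigr => i _; rewrite !fctE; congr (_ * _).
  by rewrite mxE dotE; apply: eq_bigr => j _; rewrite !mxE.
apply: differentiableB => //; apply: differentiableM; last exact: differentiable_cst.
apply: differentiable_sum => i; apply: differentiableM => //.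
exact: differentiable_coord.
Qed.

Lemma strongly_convex_quad mu :
  (forall u, mu * dot u u <= dot u (A *m u)) -> strongly_convex mu quad.
Proof.
move=> Amu; split=> [x|x x']; first exact: differentiable_quad.
by rewrite bregman_quad enorm_sqr; have := Amu (x - x'); lra.
Qed.

Lemma smooth_quad L :
  (forall u, 0 <= dot u (A *m u) <= L * dot u u) -> smooth L quad.
Proof.
move=> AL; split=> [|x x'].
  by apply: strongly_convex_quad => u; rewrite mul0r; case/andP: (AL u).
have /andP[h0 h1] := AL (x - x').
by rewrite bregman_quad enorm_sqr ger0_norm; lra.
Qed.

End quadratic.

(** * Quadratic saddle-point problems *)

Section spectrum.
Variable R : realType.

(** Eigenvectors in the sense of [eigenvalue] are rows; symmetry turns them into columns. *)
Lemma eigenvalue_form n (S : 'M[R]_n) l : S^T = S -> eigenvalue S l ->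
  exists u : 'cV[R]_n, 0 < dot u u /\ dot u (S *m u) = l * dot u u.
Proof.
move=> Ssym /eigenvalueP[v vS v0]; exists v^T; split.
  by rewrite lt0r dot_ge0 dot_eq0 trmx_eq0 v0.
by rewrite -{1}Ssym -trmx_mul vS linearZ dotZr.
Qed.

Lemma eigenvalue_col n (S : 'M[R]_n) l (u : 'cV[R]_n) :
  S^T = S -> u != 0 -> S *m u = l *: u -> eigenvalue S l.
Proof.
move=> Ssym u0 Su; apply/eigenvalueP; exists u^T; last by rewrite trmx_eq0.
by rewrite -{1}Ssym -trmx_mul Su linearZ.
Qed.

(** The second clause exhibits a positive eigenvalue of B^T B when nu is not 0, so that the infima
    defining [lambda_min] and [lambda_min_pos] range over nonempty sets: the infimum of the empty
    set is 0. *)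
Definition lower_singular n m (nu : R) (B : 'M[R]_(m, n)) : Prop :=
  (forall u, nu ^+ 2 * dot u u <= dot (B *m u) (B *m u)) /\
  (nu = 0 \/ exists2 l : R, 0 < l & exists2 u : 'cV[R]_n, u != 0 & B^T *m (B *m u) = l *: u).

Lemma gram_sym n m (B : 'M[R]_(m, n)) : (B^T *m B)^T = B^T *m B.
Proof. by rewrite trmx_mul trmxK. Qed.

Lemma gram_form n m (B : 'M[R]_(m, n)) u :
  dot u (B^T *m B *m u) = dot (B *m u) (B *m u).
Proof. by rewrite -mulmxA dot_tr trmxK. Qed.

(** Bounding both infima at once settles regularity without deciding whether the gradients lie in
    the range. *)
Lemma lower_singular_lambda n m nu (B : 'M[R]_(m, n)) :
  lower_singular nu B ->
  nu ^+ 2 <= lambda_min (B^T *m B) /\ nu ^+ 2 <= lambda_min_pos (B^T *m B).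
Proof.
move=> [Bnu nuP].
have lb l : eigenvalue (B^T *m B) l -> nu ^+ 2 <= l.
  move=> /(eigenvalue_form (gram_sym B))[u [u0 uE]].
  by rewrite -(ler_pM2r u0) -uE gram_form.
case: nuP => [nu0|[l l0 [u u0 uE]]].
  have ge0_inf (E : set R) : (forall x, E x -> 0 <= x) -> 0 <= inf E.
    move=> E0; have [->|/set0P En0] := eqVneq E set0; first by rewrite inf0.
    by apply: lb_le_inf.
  move: lb; rewrite nu0 expr0n /= => lb; split; apply: ge0_inf => l.
  - exact: lb.
  - by case=> /lb.
have ev : eigenvalue (B^T *m B) l.
  by apply: (eigenvalue_col (gram_sym B) u0); rewrite -mulmxA.
by split; apply: lb_le_inf; [exists l|move=> k /lb|exists l|move=> k [/lb]].
Qed.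

Lemma lambda_max_le n m L (B : 'M[R]_(m, n)) : 0 <= L ->
  (forall u, dot (B *m u) (B *m u) <= L * dot u u) ->
  lambda_max (B^T *m B) <= L.
Proof.
move=> L0 BL; rewrite /lambda_max; set E := [set _ | _].
have [->|/set0P En0] := eqVneq E set0; first by rewrite sup0.
apply: ge_sup => // l /(eigenvalue_form (gram_sym B))[u [u0 uE]].
by rewrite -(ler_pM2r u0) -uE gram_form.
Qed.

End spectrum.

(** * Quadratic problems with a prescribed saddle point *)

Section saddle.
Variables (R : realType) (dx dy : nat).
Variables (A : 'M[R]_dx) (G : 'M[R]_dy) (B : 'M[R]_(dy, dx)).
Variables (x0 : 'cV[R]_dx) (y0 : 'cV[R]_dy) (L : R).
Hypotheses (A_sym : A^T = A) (G_sym : G^T = G) (L0 : 0 < L).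
Hypothesis A_ge0 : forall u, 0 <= dot u (A *m u).
Hypothesis G_bnd : forall v, 0 <= dot v (G *m v) <= L * dot v v.
Hypothesis nondeg : forall u, dot u (A *m u) = 0 -> B *m u = 0 -> u = 0.

(* With these linear terms [(x0, y0)] is the saddle point. *)
Local Notation f := (quad A (A *m x0 + B^T *m y0)).
Local Notation g := (quad G (G *m y0 - B *m x0)).

Let P0 := f x0 + dot (B *m x0) y0 - g y0.

(** The linear terms of [f] and [g] cancel the first-order part of the expansion at (x0, y0). *)
Lemma lagrangian_saddle u v :
  f (x0 + u) + (dot (B *m (x0 + u)) (y0 + v) - g (y0 + v)) =
  P0 + (dot u (A *m u) / 2 + dot (B *m u) v - dot v (G *m v) / 2).
Proof.
rewrite /P0 !quadD // mulmxDr !(dotDl, dotDr, dotNl, dotNr).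
have -> : dot (B^T *m y0) u = dot (B *m u) y0.
  by rewrite dotC dot_tr trmxK.
lra.
Qed.

Lemma primal_saddle : primal f g B x0 = P0%:E.
Proof.
have -> : P0 = f x0 + (dot (B *m x0) y0 - g y0) by rewrite addrA.
rewrite EFinD /primal /fenchel; congr (_ + _)%E.
apply/le_anti/andP; split.
- apply: ge_ereal_sup => _ [y _ <-]; rewrite lee_fin.
  have := lagrangian_saddle 0 (y - y0).
  rewrite !addr0 !subrKC !mulmx0 !dot0l /P0.
  by have /andP[] := G_bnd (y - y0); lra.
- by apply: ereal_sup_ubound; exists y0.
Qed.

Lemma primal_ge u v :
  ((P0 + (dot u (A *m u) / 2 + dot (B *m u) v - dot v (G *m v) / 2))%:E
     <= primal f g B (x0 + u)%R)%E.
Proof.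
rewrite -lagrangian_saddle EFinD /primal leeD2l //.
by apply: ereal_sup_ubound; exists (y0 + v).
Qed.

Lemma primal_sol_saddle : primal_sol f g B = [set x0].
Proof.
apply/seteqP; split=> [x xsol|_ -> x /=]; last first.
  rewrite primal_saddle; have := primal_ge (x - x0) 0; rewrite subrKC.
  apply: le_trans; rewrite lee_fin !dot0l dot0r.
  by have := A_ge0 (x - x0); lra.
have ub v : dot (x - x0) (A *m (x - x0)) / 2 + dot (B *m (x - x0)) v
    - dot v (G *m v) / 2 <= 0.
  have := primal_ge (x - x0) v; rewrite subrKC => /le_trans /(_ (xsol x0)).
  by rewrite primal_saddle lee_fin; lra.
apply/eqP; rewrite -subr_eq0; apply/eqP/nondeg.
  have := ub 0; rewrite !dot0l dot0r; have := A_ge0 (x - x0).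
  by move=> *; apply/le_anti; lra.
set w := B *m (x - x0) in ub *.
apply/eqP; rewrite -dot_eq0; apply/eqP/le_anti; rewrite dot_ge0 andbT.
(* As G is at most L, the choice v = w / L gains at least |w|^2 / (2 L), which forces w = 0. *)
have := ub (L^-1 *: w); rewrite -scalemxAr !(dotZl, dotZr).
have /andP[_ Gw] := G_bnd w; have := A_ge0 (x - x0).
have : L^-1 * (L^-1 * dot w (G *m w)) <= L^-1 * dot w w.
  rewrite ler_pM2l ?invr_gt0 // -(ler_pM2l L0) mulrA divff ?mul1r //.
  by rewrite gt_eqF.
move=> h1 h2 h3; rewrite -(pmulr_rle0 _ (_ : 0 < L^-1)) ?invr_gt0 //; lra.
Qed.

End saddle.

(** Minus the dual function is the primal function of the problem with the players exchanged. *)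
Lemma dual_sol_swap (R : realType) dx dy (f : 'cV[R]_dx -> R)
    (g : 'cV[R]_dy -> R) (B : 'M[R]_(dy, dx)) :
  dual_sol f g B = primal_sol g f (- B^T).
Proof.
have dualE y : dual f g B y = (- primal g f (- B^T) y)%E.
  by rewrite /dual /primal mulNmx oppeD // fin_num_adde_defr.
by apply/seteqP; split=> y ysol y' /=; have := ysol y'; rewrite !dualE leeN2.
Qed.

(** * Regularity and distance to the solution of quadratic problems *)

Section problem.
Variable R : realType.

Definition swap_params (p : params R) : params R :=
  Params (Ly p) (Lx p) (Lxy p) (muy p) (mux p) (muyx p) (muxy p).

Record regular_forms (p : params R) (dx dy : nat)
    (A : 'M[R]_dx) (G : 'M[R]_dy) (B : 'M[R]_(dy, dx)) : Prop := {
  A_symP : A^T = A;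
  G_symP : G^T = G;
  A_bounds : forall u, mux p * dot u u <= dot u (A *m u) <= Lx p * dot u u;
  G_bounds : forall v, muy p * dot v v <= dot v (G *m v) <= Ly p * dot v v;
  B_upper : forall u, dot (B *m u) (B *m u) <= Lxy p ^+ 2 * dot u u;
  B_lower : lower_singular (muxy p) B;
  Bt_lower : lower_singular (muyx p) B^T
}.

Lemma lower_singularN n m nu (B : 'M[R]_(m, n)) :
  lower_singular nu B -> lower_singular nu (- B).
Proof.
move=> [Bnu nuP]; split=> [u|].
  by rewrite mulNmx dotNl dotNr opprK.
case: nuP => [|[l l0 [u u0 uE]]]; [by left|right].
by exists l => //; exists u => //; rewrite linearN !mulNmx mulmxN opprK.
Qed.

Lemma regular_forms_swap p dx dy (A : 'M[R]_dx) (G : 'M[R]_dy) B :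
  0 < Lxy p -> regular_forms p A G B ->
  regular_forms (swap_params p) G A (- B^T).
Proof.
move=> L0 [As Gs Ab Gb Bu Bl Btl]; split=> //=.
- move=> v; rewrite mulNmx dotNl dotNr opprK.
  by apply: mulmx_tr_bound => //; rewrite exprn_gt0.
- exact: lower_singularN.
- by rewrite linearN /= trmxK; apply: lower_singularN.
Qed.

Section regular.
Variables (p : params R) (dx dy : nat).
Variables (A : 'M[R]_dx) (G : 'M[R]_dy) (B : 'M[R]_(dy, dx)).
Hypotheses (padm : admissible p) (AGB : regular_forms p A G B).

Lemma regular_quad a b : regular p (quad A a) (quad G b) B.
Proof.
case: padm AGB => /andP[mux0 _] /andP[muy0 _] _ _ _ [As Gs Ab Gb Bu Bl Btl].
have A0 u : 0 <= dot u (A *m u) <= Lx p * dot u u.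
  have /andP[h ->] := Ab u; rewrite andbT; apply: le_trans h.
  by rewrite mulr_ge0 // dot_ge0.
have G0 u : 0 <= dot u (G *m u) <= Ly p * dot u u.
  have /andP[h ->] := Gb u; rewrite andbT; apply: le_trans h.
  by rewrite mulr_ge0 // dot_ge0.
have [l1 l2] := lower_singular_lambda Bl.
have := lower_singular_lambda Btl; rewrite trmxK => -[l3 l4].
split; [|split; [|split; [|split]]].
- split; last exact: smooth_quad.
  by apply: strongly_convex_quad => // u; case/andP: (Ab u).
- split; last exact: smooth_quad.
  by apply: strongly_convex_quad => // u; case/andP: (Gb u).
- by split.
- by split.
- by apply: lambda_max_le => //; rewrite sqr_ge0.
Qed.

(** A nonzero u would force mux <= 0 and muxy = 0, hence deltax <= 0. *)
Lemma form_nondeg u : 0 < deltax p ->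
  dot u (A *m u) = 0 -> B *m u = 0 -> u = 0.
Proof.
case: AGB => _ _ Ab _ _ [Bl _] _ d0 Au Bu.
apply/eqP; rewrite -dot_eq0; apply: contraTT d0 => u0.
have {}u0 : 0 < dot u u by rewrite lt0r u0 dot_ge0.
have /andP[h _] := Ab u; rewrite Au pmulr_lle0 // in h.
have := Bl u; rewrite Bu dot0l => h'; rewrite pmulr_lle0 // in h'.
have muxy0 : muxy p = 0.
  by apply/eqP; rewrite -sqrf_eq0 eq_le h' sqr_ge0.
by rewrite -leNgt /deltax muxy0 expr0n /= mul0r addr0.
Qed.

End regular.

Lemma dist_set1 n (x x0 : 'cV[R]_n) :
  dist x [set x0] = (enorm (x - x0))%:E.
Proof. by rewrite /dist image_set1 ereal_inf1. Qed.

Lemma R2_quad (p : params R) dx dy (A : 'M[R]_dx) (G : 'M[R]_dy)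
    (B : 'M[R]_(dy, dx)) x0 y0 x y :
  admissible p -> 0 < deltax p -> 0 < deltay p -> regular_forms p A G B ->
  R2 p (quad A (A *m x0 + B^T *m y0)) (quad G (G *m y0 - B *m x0)) B x y =
  (deltax p * dot (x - x0) (x - x0) + deltay p * dot (y - y0) (y - y0))%:E.
Proof.
move=> padm dx0 dy0 AGB.
have [/andP[mux0 Lx0] /andP[muy0 Ly0] /andP[muxy0 Lxy0] _ _] := padm.
have AGB' := regular_forms_swap (le_lt_trans muxy0 Lxy0) AGB.
have [As Gs Ab Gb _ _ _] := AGB.
have A0 u : 0 <= dot u (A *m u) <= Lx p * dot u u.
  have /andP[h ->] := Ab u; rewrite andbT; apply: le_trans h.
  by rewrite mulr_ge0 // dot_ge0.
have G0 u : 0 <= dot u (G *m u) <= Ly p * dot u u.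
  have /andP[h ->] := Gb u; rewrite andbT; apply: le_trans h.
  by rewrite mulr_ge0 // dot_ge0.
have psol : primal_sol (quad A (A *m x0 + B^T *m y0))
    (quad G (G *m y0 - B *m x0)) B = [set x0].
  apply: (@primal_sol_saddle _ _ _ _ _ _ _ _ (Ly p)) => //.
  - exact: le_lt_trans Ly0.
  - by move=> u; case/andP: (A0 u).
  - by move=> u; apply: (form_nondeg AGB).
have dsol : dual_sol (quad A (A *m x0 + B^T *m y0))
    (quad G (G *m y0 - B *m x0)) B = [set y0].
  rewrite dual_sol_swap.
  have -> : G *m y0 - B *m x0 = G *m y0 + (- B^T)^T *m x0.
    by rewrite linearN /= trmxK mulNmx.
  have -> : A *m x0 + B^T *m y0 = A *m x0 - (- B^T) *m y0.
    by rewrite mulNmx opprK.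
  apply: (@primal_sol_saddle _ _ _ _ _ _ _ _ (Lx p)) => //.
  - exact: le_lt_trans Lx0.
  - by move=> u; case/andP: (G0 u).
  - by move=> u; apply: (form_nondeg AGB').
by rewrite /R2 psol dsol !dist_set1 -!EFin_expe !enorm_sqr -!EFinM -EFinD.
Qed.

End problem.

(** * The memory of a first-order method *)

Definition linear_set (R : realType) n (V : set 'cV[R]_n) : Prop :=
  V 0 /\ forall a u v, V u -> V v -> V (a *: u + v).

Section linear_set.
Variables (R : realType) (n : nat) (V : set 'cV[R]_n).
Hypothesis Vlin : linear_set V.

Lemma linear_setZ a u : V u -> V (a *: u).
Proof. by case: Vlin => V0 Vl Vu; rewrite -[_ *: _]addr0; apply: Vl. Qed.

Lemma linear_setD u v : V u -> V v -> V (u + v).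
Proof. by case: Vlin => V0 Vl Vu Vv; rewrite -[u]scale1r; apply: Vl. Qed.

Lemma linear_setN u : V u -> V (- u).
Proof. by move=> Vu; rewrite -scaleN1r; apply: linear_setZ. Qed.

End linear_set.

Section memory_invariant.
Variable R : realType.

Lemma lin_span_sub n (V S : set 'cV[R]_n) :
  linear_set V -> S `<=` V -> lin_span S `<=` V.
Proof.
move=> [V0 Vlin] SV v [s sS /(@coord_span _ _ _ (in_tuple s)) ->].
apply: (big_ind V) => // [u w Vu Vw|i _].
  by rewrite -[u]scale1r; apply: Vlin.
rewrite -[_ *: _]addr0; apply: Vlin => //; apply/SV/sS.
exact: mem_nth.
Qed.

Variables (dx dy : nat) (f : 'cV[R]_dx -> R) (g : 'cV[R]_dy -> R).
Variables (B : 'M[R]_(dy, dx)) (tf tg tB tau : R) (cf cg cB : bool).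
Variables (Vx : nat -> set 'cV[R]_dx) (Vy : nat -> set 'cV[R]_dy).
Hypotheses (tf0 : 0 < tf) (tg0 : 0 < tg) (tB0 : 0 < tB).
Hypotheses (tau_f : cf -> tau <= tf) (tau_g : cg -> tau <= tg).
Hypothesis (tau_B : cB -> tau <= tB).
Hypotheses (Vx_lin : forall k, linear_set (Vx k)).
Hypotheses (Vy_lin : forall k, linear_set (Vy k)).
Hypotheses (Vx_mono : forall k, Vx k `<=` Vx k.+1).
Hypotheses (Vy_mono : forall k, Vy k `<=` Vy k.+1).
Hypothesis grad_f : forall k x, Vx k x -> Vx (k + cf)%N (grad f x).
Hypothesis grad_g : forall k y, Vy k y -> Vy (k + cg)%N (grad g y).
Hypothesis mul_B : forall k x, Vx k x -> Vy (k + cB)%N (B *m x).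
Hypothesis mul_Bt : forall k y, Vy k y -> Vx (k + cB)%N (B^T *m y).

(** Each counted call lasts at least [tau], so at most k of them in sequence are finished before
    time (k + 1) tau. The other calls stay inside [Vx k] and [Vy k]. *)
Lemma memory_invariant Mx My xo yo :
  first_order_method f g B tf tg tB Mx My xo yo ->
  forall t k, 0 <= t -> t < k.+1%:R * tau -> Mx t `<=` Vx k /\ My t `<=` Vy k.
Proof.
move=> [_ _ Mx_sub My_sub _].
(* Real time is not well founded. Every oracle reads a memory at least [d] older, so the induction
   runs over the number N of intervals of length [d]. *)
set d := Num.min tf (Num.min tg tB).
have d0 : 0 < d by rewrite !lt_min tf0 tg0 tB0.
have [df dg dB] : [/\ d <= tf, d <= tg & d <= tB].
  by rewrite /d !ge_min !lexx ?orbT.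
have monox k c x : Vx k x -> Vx (k + nat_of_bool c)%N x.
  by case: c; rewrite ?addn1 ?addn0 //; apply: Vx_mono.
have monoy k c y : Vy k y -> Vy (k + nat_of_bool c)%N y.
  by case: c; rewrite ?addn1 ?addn0 //; apply: Vy_mono.
suff inv N t k : 0 <= t -> t < N%:R * d -> t < k.+1%:R * tau ->
    Mx t `<=` Vx k /\ My t `<=` Vy k.
  move=> t k t0; apply: (inv (Num.truncn (t / d)).+1) => //.
  by rewrite -ltr_pdivrMr //; apply: truncnS_gt.
elim: N t k => [|N IHN] t k t0; first by rewrite mul0r ltNge t0.
move=> tN tk.
(* An oracle of duration T reads the memory of time t - T. If it is counted, the index drops by one;
   k = 0 is then impossible because t < tau <= T <= t. *)
have back (T : R) (c : bool) : 0 < T -> d <= T -> (c -> tau <= T) -> T <= t ->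
    exists2 k', k = (k' + c)%N &
      Mx (t - T) `<=` Vx k' /\ My (t - T) `<=` Vy k'.
  move=> T0 dT tauT Tt.
  have tN' : t - T < N%:R * d by move: tN; rewrite -natr1 mulrDl mul1r; lra.
  case: c tauT => [/(_ isT) tauT|_]; last first.
    by exists k; rewrite ?addn0 //; apply: IHN => //; lra.
  case: k tk => [|k] tk; first by move: tk; rewrite mul1r; lra.
  exists k; rewrite ?addn1 //; apply: IHN => //; first by rewrite subr_ge0.
  by move: tk; rewrite -(natr1 k.+1) mulrDl mul1r; lra.
split=> [x /(Mx_sub t t0)|y /(My_sub t t0)].
- case; rewrite /mem_f /mem_Bt; case: ifP => [Tt|_]; try by move=> ->; case: (Vx_lin k).
  + have [k' -> [Mx' _]] := back tf cf tf0 df tau_f Tt.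
    apply: lin_span_sub => // _ [z /Mx' Vz] [->|->]; [exact: monox|exact: grad_f].
  + have [k' -> [Mx' My']] := back tB cB tB0 dB tau_B Tt.
    apply: lin_span_sub => // _ [z [/Mx' Vz /My' Wz]] [->|->]; [exact: monox|exact: mul_Bt].
- case; rewrite /mem_g /mem_B; case: ifP => [Tt|_]; try by move=> ->; case: (Vy_lin k).
  + have [k' -> [_ My']] := back tg cg tg0 dg tau_g Tt.
    apply: lin_span_sub => // _ [z /My' Vz] [->|->]; [exact: monoy|exact: grad_g].
  + have [k' -> [Mx' My']] := back tB cB tB0 dB tau_B Tt.
    apply: lin_span_sub => // _ [z [/Mx' Vz /My' Wz]] [->|->]; [exact: mul_B|exact: monoy].
Qed.

End memory_invariant.

(** * From growing subspaces to lower bounds on the execution time *)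

Section hardness.
Variable R : realType.

(** The lower bound T is left abstract so that each oracle can be treated apart. *)
Definition hard (p : params R) (r eps tf tg tB T : R) : Prop :=
  exists (dx dy : nat) (f : 'cV[R]_dx -> R) (g : 'cV[R]_dy -> R)
         (B : 'M[R]_(dy, dx)),
    (0 < dx)%N /\ (0 < dy)%N /\
    regular p f g B /\
    R2 p f g B 0 0 = (r ^+ 2)%:E /\
    forall (Mx : R -> set 'cV[R]_dx) (My : R -> set 'cV[R]_dy)
           (xo : R -> 'cV[R]_dx) (yo : R -> 'cV[R]_dy),
      first_order_method f g B tf tg tB Mx My xo yo ->
      forall t : R, 0 <= t ->
        (R2 p f g B (xo t) (yo t) < eps%:E)%E -> T <= t.

(* [cf], [cg], [cB] tell which oracle (gradient of f, gradient of g, products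
   with B) is counted; [cVx k], [cVy k] contain all vectors computable with
   [k] calls to it. *)
Record chain_quad (p : params R) (cf cg cB : bool) (w : R) (m : nat) := {
  cdx : nat;
  cdy : nat;
  cA : 'M[R]_cdx;
  cG : 'M[R]_cdy;
  cmxB : 'M[R]_(cdy, cdx);
  cx : 'cV[R]_cdx;
  cy : 'cV[R]_cdy;
  cVx : nat -> set 'cV[R]_cdx;
  cVy : nat -> set 'cV[R]_cdy;
  cdx_gt0 : (0 < cdx)%N;
  cdy_gt0 : (0 < cdy)%N;
  c_regular : regular_forms p cA cG cmxB;
  cVx_lin : forall k, linear_set (cVx k);
  cVy_lin : forall k, linear_set (cVy k);
  cVx_mono : forall k, cVx k `<=` cVx k.+1;
  cVy_mono : forall k, cVy k `<=` cVy k.+1;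
  c_mulA : forall k x, cVx k x -> cVx (k + cf)%N (cA *m x);
  c_mulG : forall k y, cVy k y -> cVy (k + cg)%N (cG *m y);
  c_mulB : forall k x, cVx k x -> cVy (k + cB)%N (cmxB *m x);
  c_mulBt : forall k y, cVy k y -> cVx (k + cB)%N (cmxB^T *m y);
  c_resx : cVx 0 (cA *m cx + cmxB^T *m cy);
  c_resy : cVy 0 (cG *m cy - cmxB *m cx);
  c_gt0 : 0 < deltax p * dot cx cx + deltay p * dot cy cy;
  c_decay : forall k x y, (k <= m)%N -> cVx k x -> cVy k y ->
    expR (- (4 * w * k.+1%:R)) / 3 *
      (deltax p * dot cx cx + deltay p * dot cy cy) <=
    deltax p * dot (x - cx) (x - cx) + deltay p * dot (y - cy) (y - cy)
}.

Arguments cVx {p cf cg cB w m} c k _.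
Arguments cVy {p cf cg cB w m} c k _.
Arguments cVx_lin {p cf cg cB w m} c k.
Arguments cVy_lin {p cf cg cB w m} c k.
Arguments c_decay {p cf cg cB w m} c [k x y] _ _ _.

(** Changing the sign of the objective exchanges minimum and maximum, which is why B becomes
    -B^T. *)
Definition chain_swap p cf cg cB w m (Lxy0 : 0 < Lxy p)
  (q : chain_quad p cf cg cB w m) : chain_quad (swap_params p) cg cf cB w m.
Proof.
refine (@Build_chain_quad (swap_params p) cg cf cB w m (cdy q) (cdx q) (cG q)
  (cA q) (- (cmxB q)^T) (cy q) (cx q) (cVy q) (cVx q) _ _ _ _ _ _ _ _ _ _ _ _ _ _ _).
- exact: cdy_gt0.
- exact: cdx_gt0.
- by apply: regular_forms_swap => //; exact: c_regular.
- exact: cVy_lin.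
- exact: cVx_lin.
- exact: cVy_mono.
- exact: cVx_mono.
- exact: c_mulG.
- exact: c_mulA.
- move=> k y Vy; rewrite mulNmx -scaleN1r -[_ *: _]addr0.
  by have [V0 Vl] := cVx_lin q (k + cB); apply: Vl => //; exact: c_mulBt.
- move=> k x Vx; rewrite linearN /= trmxK mulNmx -scaleN1r -[_ *: _]addr0.
  by have [V0 Vl] := cVy_lin q (k + cB); apply: Vl => //; exact: c_mulB.
- by rewrite linearN /= trmxK mulNmx; exact: c_resy.
- by rewrite mulNmx opprK; exact: c_resx.
- by rewrite addrC; exact: c_gt0.
- move=> k y x km Vy Vx; rewrite addrC [leRHS]addrC; exact: c_decay.
Defined.

(** Let k be the integer part of t / tau. For k < m the output lies in the k-th subspaces, so an
    error below eps forces r^2 expR (-4 w (k + 1)) / 3 < eps. This bounds k from below, hence t >= k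
    tau. *)
Lemma chain_hard p cf cg cB w m (q : chain_quad p cf cg cB w m)
    (r eps tf tg tB tau : R) :
  admissible p -> 0 < deltax p -> 0 < deltay p ->
  0 < r -> 0 < eps -> 0 < tf -> 0 < tg -> 0 < tB -> 0 < tau ->
  (cf -> tau <= tf) -> (cg -> tau <= tg) -> (cB -> tau <= tB) ->
  0 < w <= 2 ->
  tau / (4 * w) * ln (expR (- 8) / 3 * r ^+ 2 / eps) <= m%:R * tau ->
  hard p r eps tf tg tB (tau / (4 * w) * ln (expR (- 8) / 3 * r ^+ 2 / eps)).
Proof.
move=> padm dx0 dy0 r0 e0 tf0 tg0 tB0 tau0 hf hg hB /andP[w0 w2] Tm.
set T := tau / (4 * w) * _ in Tm *.
set M := deltax p * dot (cx q) (cx q) + deltay p * dot (cy q) (cy q).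
have M0 : 0 < M := c_gt0 q.
(* Scaling the solution by [s] makes the initial distance equal to [r]; the subspaces are linear and
   do not change. *)
pose s := r / Num.sqrt M.
have s0 : 0 < s by rewrite divr_gt0 // sqrtr_gt0.
have s2 : s ^+ 2 * M = r ^+ 2.
  by rewrite expr_div_n sqr_sqrtr ?ltW // divfK // gt_eqF.
pose x0 := s *: cx q; pose y0 := s *: cy q.
pose bx := cA q *m x0 + (cmxB q)^T *m y0; pose gy := cG q *m y0 - cmxB q *m x0.
have Vbx k : cVx q k bx.
  elim: k => [|k]; last exact: cVx_mono.
  by rewrite /bx -!scalemxAr -scalerDr; apply: linear_setZ; [exact: cVx_lin|exact: c_resx].
have Vgy k : cVy q k gy.
  elim: k => [|k]; last exact: cVy_mono.
  by rewrite /gy -!scalemxAr -scalerBr; apply: linear_setZ; [exact: cVy_lin|exact: c_resy].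
exists (cdx q), (cdy q), (quad (cA q) bx), (quad (cG q) gy), (cmxB q).
have AGB := c_regular q.
split; first exact: cdx_gt0.
split; first exact: cdy_gt0.
split; first exact: regular_quad.
split.
  rewrite R2_quad // !sub0r !dotNl !dotNr !opprK /x0 /y0 !dotZl !dotZr.
  by rewrite -s2 /M; congr EFin; ring.
move=> Mx My xo yo meth t t0; rewrite R2_quad // lte_fin => Rt.
pose k := Num.truncn (t / tau).
have [kt tk] : k%:R * tau <= t /\ t < k.+1%:R * tau.
  rewrite -ler_pdivlMr // -ltr_pdivrMr //; apply/andP/truncn_itv.
  by rewrite divr_ge0 // ltW.
(* Beyond m calls there is no decay estimate, but then T <= m tau <= k tau <= t. *)
have [mk|km] := leqP m k.
  by apply: le_trans Tm (le_trans _ kt); rewrite ler_pM2r // ler_nat.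
have [Mxt Myt] : Mx t `<=` cVx q k /\ My t `<=` cVy q k.
  apply: (memory_invariant (cf := cf) (cg := cg) (cB := cB) tf0 tg0 tB0 hf hg hB
    _ _ _ _ _ _ _ _ meth t0 tk).
  - exact: cVx_lin.
  - exact: cVy_lin.
  - exact: cVx_mono.
  - exact: cVy_mono.
  - move=> j x Vx; rewrite grad_quad; last exact: A_symP AGB.
    by apply: (linear_setD (cVx_lin q _)); [|apply: (linear_setN (cVx_lin q _))]; first exact: c_mulA.
  - move=> j x Vx; rewrite grad_quad; last exact: G_symP AGB.
    by apply: (linear_setD (cVy_lin q _)); [|apply: (linear_setN (cVy_lin q _))]; first exact: c_mulG.
  - exact: c_mulB.
  - exact: c_mulBt.
have [_ _ _ _ /(_ t t0)[/Mxt Vxo /Myt Vyo]] := meth.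
have scl n (u v : 'cV[R]_n) :
    dot (u - s *: v) (u - s *: v) = s ^+ 2 * dot (s^-1 *: u - v) (s^-1 *: u - v).
  have -> : u - s *: v = s *: (s^-1 *: u - v).
    by rewrite scalerBr scalerA divff ?scale1r // gt_eqF.
  by rewrite dotZl dotZr mulrA -expr2.
have := c_decay q (ltnW km)
  (linear_setZ (cVx_lin q k) s^-1 Vxo) (linear_setZ (cVy_lin q k) s^-1 Vyo).
rewrite -/M -(ler_pM2l (exprn_gt0 2 s0)) mulrCA s2 mulrDr.
rewrite [s ^+ 2 * (deltax p * _)]mulrCA [s ^+ 2 * (deltay p * _)]mulrCA -!scl.
move=> /le_lt_trans /(_ Rt) lt_eps.
apply: le_trans kt.
have w4 : 0 < 4 * w by rewrite mulr_gt0.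
rewrite /T mulrAC ler_pdivrMr //.
have -> : k%:R * tau * (4 * w) = tau * (k%:R * (4 * w)) by ring.
rewrite ler_pM2l //; set a := 4 * w * k.+1%:R in lt_eps.
(* The factor expR (- 8) pays for the passage from k + 1 to k, since 4 w <= 8. *)
have lnlt : expR (- 8) / 3 * r ^+ 2 / eps <= expR (a - 8).
  rewrite ler_pdivrMr // expRD; have a0 := expR_gt0 a.
  have : r ^+ 2 / 3 <= expR a * eps.
    rewrite -ler_pdivrMl // -expRN; apply/ltW.
    by move: lt_eps; rewrite -mulrA (mulrC 3^-1).
  by rewrite -(ler_pM2l (expR_gt0 (- 8 : R))); lra.
rewrite -ler_expR lnK; last first.
  by rewrite posrE divr_gt0 // !mulr_gt0 ?expR_gt0 ?exprn_gt0 // invr_gt0.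
apply: le_trans lnlt _; rewrite ler_expR /a -natr1; lra.
Qed.

End hardness.

(** * Geometric sequences on a path *)

Section path.
Variables (R : realType) (N : nat).
Local Notation n := N.+1.
Implicit Types v : 'cV[R]_n.

(** The last row is zero, so D^T D is the Laplacian of a path with free ends and constants lie in
    the kernel. *)
Definition path_diff : 'M[R]_n :=
  \matrix_(i, j) if (i < N)%N then (j == i)%:R - (j == i.+1 :> nat)%:R else 0.

Definition geo (q : R) : 'cV[R]_n := \col_i q ^+ i.

(** Vectors supported on the first [a] and the last [b] vertices, the part of the path explored from
    either end. *)
Definition ends (a b : nat) : set 'cV[R]_n :=
  [set v | forall i : 'I_n, (a <= i)%N -> (i + b < n)%N -> v i 0 = 0].

Lemma path_diffE v i :
  (path_diff *m v) i 0 = if (i < N)%N then v i 0 - v (inord i.+1) 0 else 0.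
Proof.
rewrite mxE; case: ifP => iN; last first.
  by rewrite big1 // => j _; rewrite mxE iN mul0r.
under eq_bigr do rewrite mxE iN mulrBl.
rewrite sumrB (bigD1 i) //= eqxx mul1r big1 ?addr0 => [|j /negPf ->]; last by rewrite mul0r.
rewrite (bigD1 (inord i.+1)) //= inordK // eqxx mul1r big1 ?addr0 // => j ji.
suff /negPf -> : (j != i.+1 :> nat) by rewrite mul0r.
by apply: contra ji => /eqP ji; rewrite -ji inord_val.
Qed.

Lemma path_diff_trE v i :
  (path_diff^T *m v) i 0 =
  (if (i < N)%N then v i 0 else 0) - (if (0 < i)%N then v (inord i.-1) 0 else 0).
Proof.
rewrite mxE (eq_bigr (fun j : 'I_n =>
  (if (j < N)%N && (j == i) then v j 0 else 0) -
  (if (j < N)%N && (i == j.+1 :> nat) then v j 0 else 0))); last first.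
  move=> j _; rewrite !mxE [i == j]eq_sym; case: (j < N)%N => /=; last by rewrite mul0r subr0.
  by rewrite mulrBl; do 2 case: ifP; rewrite ?mul1r ?mul0r.
rewrite sumrB; congr (_ - _).
  rewrite (bigD1 i) //= eqxx andbT big1 ?addr0 // => j /negPf ->.
  by rewrite andbF.
case: ifP => i0; last first.
  by rewrite big1 // => j _; case: ifP => // /andP[_ /eqP ij]; rewrite ij in i0.
have iN := ltn_ord i; have ei := prednK i0.
have ki : nat_of_ord (inord i.-1 : 'I_n) = i.-1 by apply: inordK; lia.
rewrite (bigD1 (inord i.-1)) //= ki ei eqxx andbT ifT; last by lia.
rewrite big1 ?addr0 // => j ji; case: ifP => // /andP[_ /eqP ij].
by move: ji; rewrite ij /= inord_val eqxx.
Qed.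

Lemma ends_lin a b : linear_set (ends a b).
Proof.
split=> [i _ _|c u v Vu Vv i ai ib]; first by rewrite mxE.
by rewrite !mxE Vu // Vv // mulr0 addr0.
Qed.

Lemma ends_sub a b a' b' : (a <= a')%N -> (b <= b')%N -> ends a b `<=` ends a' b'.
Proof. by move=> aa bb v Vv i ai ib; apply: Vv; lia. Qed.

(** Entry i reads the vertices i and i + 1, so the support grows at the right end only. The
    transpose reads i - 1 and i and lets it grow at the left end only. *)
Lemma ends_diff a b v : ends a b v -> ends a b.+1 (path_diff *m v).
Proof.
move=> Vv i ai ib; rewrite path_diffE; case: ifP => // iN.
by rewrite !Vv ?subr0 ?inordK //; lia.
Qed.

Lemma ends_diff_tr a b v : ends a b v -> ends a.+1 b (path_diff^T *m v).
Proof.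
move=> Vv i ai ib; rewrite path_diff_trE.
have -> : (0 < i)%N by lia.
rewrite (_ : (if _ then v i 0 else 0) = 0) ?sub0r; last first.
  by case: ifP => // _; apply: Vv; lia.
by rewrite Vv ?oppr0 ?inordK //; lia.
Qed.

(** Away from the ends a geometric sequence is an eigenvector of the difference and of its
    transpose; only the end vertices leave a residual. *)
Lemma diff_geo q : ends 0 1 (path_diff *m geo q - (1 - q) *: geo q).
Proof.
move=> i _ ib; rewrite mxE path_diffE !mxE.
have -> : (i < N)%N by lia.
by rewrite inordK ?exprS; [ring|lia].
Qed.

Lemma diff_tr_geo q : q != 0 ->
  ends 1 1 (path_diff^T *m geo q - (1 - q^-1) *: geo q).
Proof.
move=> q0 i ia ib; rewrite mxE path_diff_trE !mxE.
have -> : (i < N)%N by lia.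
rewrite ia inordK; last by lia.
by rewrite -{1 3}(prednK ia) !exprS; field.
Qed.

Lemma diff_diff_geo q : q != 0 ->
  ends 1 1 (path_diff^T *m (path_diff *m geo q) -
            ((1 - q) * (1 - q^-1)) *: geo q).
Proof.
move=> q0; have [E0 El] := ends_lin 1 1.
set e := path_diff *m geo q - (1 - q) *: geo q.
(* The residual [e] sits at the last vertex, and the transpose spreads it at most to the first
   one. *)
have -> : path_diff *m geo q = (1 - q) *: geo q + e by rewrite subrKC.
rewrite mulmxDr -scalemxAr -scalerA addrAC -scalerBr.
by apply: El; [exact: diff_tr_geo|apply/ends_diff_tr/diff_geo].
Qed.

Lemma diff_const c : path_diff *m const_mx c = 0 :> 'cV[R]_n.
Proof.
by apply/colP => i; rewrite path_diffE !mxE; case: ifP => // _; rewrite subrr.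
Qed.

(** On each edge (a - b)^2 <= 2 a^2 + 2 b^2, and a vertex lies on at most two edges. *)
Lemma diff_bound v : dot (path_diff *m v) (path_diff *m v) <= 4 * dot v v.
Proof.
rewrite !dotE.
under eq_bigr do rewrite path_diffE.
rewrite big_ord_recr /= ltnn mul0r addr0.
have vr : \sum_(i < n) v i 0 * v i 0 =
    \sum_(i < N) v (inord i) 0 * v (inord i) 0 + v ord_max 0 * v ord_max 0.
  rewrite big_ord_recr /=; congr (_ + _); apply: eq_bigr => i _.
  by rewrite -[widen_ord _ i]inord_val.
have vl : \sum_(i < n) v i 0 * v i 0 =
    v ord0 0 * v ord0 0 + \sum_(i < N) v (inord i.+1) 0 * v (inord i.+1) 0.
  rewrite big_ord_recl; congr (_ + _); apply: eq_bigr => i _.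
  have -> // : lift ord0 i = inord i.+1 :> 'I_n.
  by apply/val_inj; rewrite /= inordK // ltnS.
apply: (@le_trans _ _ (\sum_(i < N) (2 * (v (inord i) 0 * v (inord i) 0) +
    2 * (v (inord i.+1) 0 * v (inord i.+1) 0)))).
  apply: ler_sum => i _; rewrite ltn_ord -[widen_ord _ i]inord_val /=.
  by have := sqr_ge0 (v (inord i) 0 + v (inord i.+1) 0); nra.
rewrite big_split /= -!mulr_sumr.
by have := sqr_ge0 (v ord0 0); have := sqr_ge0 (v ord_max 0); nra.
Qed.

(* The middle block dominates: it contains [q ^+ K] times a copy of the first
   block, and the last block is at most [q ^+ K] times the first one. *)
Lemma geo_decay q X K v : 0 <= q <= 1 -> (3 * K <= n)%N -> ends K K v ->
  (q ^+ 2) ^+ K / 3 * dot (X *: geo q) (X *: geo q) <=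
  dot (v - X *: geo q) (v - X *: geo q).
Proof.
move=> /andP[q0 q1] Kn Vv; set Q := q ^+ 2.
have Q0 : 0 <= Q by exact: sqr_ge0.
have QK0 : 0 <= Q ^+ K by exact: exprn_ge0.
have QK1 : Q ^+ K <= 1 by rewrite exprn_ile1 // exprn_ile1.
pose S a b := \sum_(a <= i < b) Q ^+ i.
have S0 a b : 0 <= S a b by apply: sumr_ge0 => i _; exact: exprn_ge0.
have shift c a b : S (a + c)%N (b + c)%N = Q ^+ c * S a b.
  rewrite /S big_addn addnK mulr_sumr.
  by apply: eq_bigr => i _; rewrite exprD mulrC.
have mid : X ^+ 2 * S K (n - K)%N <= dot (v - X *: geo q) (v - X *: geo q).
  rewrite dotE /S (big_nat_widenl _ 0) // (big_nat_widen _ _ n) ?leq_subr //=.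
  rewrite big_mkord mulr_sumr [leLHS]big_mkcond /=; apply: ler_sum => i _.
  rewrite -expr2; case: ifP => [/andP[iK ib]|_]; last exact: sqr_ge0.
  rewrite !mxE Vv ?sub0r; [|lia|lia].
  by rewrite sqrrN [leRHS]exprMn /Q exprAC.
have -> : dot (X *: geo q) (X *: geo q) = X ^+ 2 * S 0%N n.
  rewrite dotZl dotZr mulrA -expr2 dotE /S big_mkord; congr (_ * _).
  by apply: eq_bigr => i _; rewrite !mxE -expr2 exprAC.
have -> : S 0%N n = S 0%N K + S K (n - K)%N + S (n - K)%N n.
  by rewrite /S -!big_cat_nat //=; lia.
have first : Q ^+ K * S 0%N K <= S K (n - K)%N.
  rewrite -shift add0n /S [leRHS](@big_cat_nat _ _ _ (K + K)) /=; [|lia|lia].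
  by rewrite lerDl sumr_ge0 // => i _; exact: exprn_ge0.
have last : S (n - K)%N n <= S 0%N K.
  have -> : S (n - K)%N n = S (0 + (n - K))%N (K + (n - K))%N.
    by congr S; lia.
  by rewrite shift ler_piMl // exprn_ile1 // exprn_ile1.
apply: le_trans mid; rewrite mulrCA ler_wpM2l ?sqr_ge0 //.
have := ler_wpM2l QK0 last; have := ler_wpM2r (S0 K (n - K)%N) QK1; lra.
Qed.

End path.

(** * Block vectors and multiples of isometries *)

Section blocks.
Variable R : realType.

Definition col_set n1 n2 (V : set 'cV[R]_n1) (W : set 'cV[R]_n2) :
    set 'cV[R]_(n1 + n2) := [set x | V (usubmx x) /\ W (dsubmx x)].

Lemma col_setE n1 n2 (V : set 'cV[R]_n1) (W : set 'cV[R]_n2) u v :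
  V u -> W v -> col_set V W (col_mx u v).
Proof. by rewrite /col_set /= col_mxKu col_mxKd. Qed.

Lemma col_set_lin n1 n2 (V : set 'cV[R]_n1) (W : set 'cV[R]_n2) :
  linear_set V -> linear_set W -> linear_set (col_set V W).
Proof.
move=> [V0 Vl] [W0 Wl]; split=> [|a u v [Vu Wu] [Vv Wv]].
  by rewrite -[0]vsubmxK; apply: col_setE; rewrite linear0.
by split; rewrite linearP; [apply: Vl|apply: Wl].
Qed.

Lemma lower_singular_isometry n d (nu mu : R) (B : 'M[R]_(d, n.+1)) :
  0 <= nu <= mu -> B^T *m B = (mu ^+ 2)%:M -> lower_singular nu B.
Proof.
move=> /andP[nu0 num] BB; have mu0 := le_trans nu0 num; split=> [u|].
  rewrite -gram_form BB mul_scalar_mx dotZr ler_wpM2r ?dot_ge0 //.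
  by rewrite ler_sqr ?nnegrE.
have [nu_gt0|] := ltP 0 nu; last by move=> h; left; apply/le_anti; rewrite h.
right; exists (mu ^+ 2); first by rewrite exprn_gt0 // (lt_le_trans nu_gt0).
exists (const_mx 1); last by rewrite mulmxA BB mul_scalar_mx.
by apply/eqP => /colP /(_ ord0); rewrite !mxE; apply/eqP; exact: oner_neq0.
Qed.

End blocks.

Section ratio.
Variable R : realType.

(** The positive root of rho^2 + w rho - 1. The rate follows from 1 / rho = rho + w <= 1 + w <= expR
    w. *)
Lemma rho_exists (w : R) : 0 < w ->
  exists rho : R, [/\ 0 < rho < 1, rho^-1 - rho = w & expR (- w) <= rho].
Proof.
move=> w0; set s := Num.sqrt (w ^+ 2 + 4).
have s2 : s ^+ 2 = w ^+ 2 + 4 by rewrite sqr_sqrtr // addr_ge0 // sqr_ge0.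
have s0 : 0 <= s by exact: sqrtr_ge0.
have ws : w < s by rewrite -(ltr_pXn2r (_ : 0 < 2)%N) ?nnegrE ?s2 ?ltrDl // ltW.
have s_ub : s < w + 2 by nra.
pose rho := (s - w) / 2.
have rho0 : 0 < rho by rewrite /rho; lra.
have rE : rho^-1 = rho + w.
  by apply: (mulfI (lt0r_neq0 rho0)); rewrite divff ?lt0r_neq0 // /rho; nra.
have rho1 : rho < 1 by rewrite /rho; lra.
exists rho; split; [by rewrite rho0 | by rewrite rE; ring|].
rewrite expRN -[rho]invrK rE lef_pV2 ?posrE ?expR_gt0 //; last by lra.
by apply: le_trans (expR_ge1Dx w); lra.
Qed.

End ratio.

(** * The geometric solution and the explored frames of the path *)

Section chain.
Variables (R : realType) (m : nat) (w rho : R).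
Hypotheses (rho01 : 0 < rho < 1) (rhoE : rho^-1 - rho = w).
Hypothesis rho_exp : expR (- w) <= rho.

Local Notation N := (3 * m).+2.
Local Notation n := N.+1.
Local Notation D := (path_diff R N).

(** With ratio rho^2, the interior eigenvalues are rho w for D, -w / rho for D^T and -w^2 for D^T D.
    The last one is negative and can balance a positive curvature. *)
Definition gvec : 'cV[R]_n := geo N (rho ^+ 2).
Local Notation g := gvec.

(** The shift by one lets [frame 0] contain the end vertices, where the linear terms live. *)
Definition frame (k : nat) : set 'cV[R]_n := ends k.+1 k.+1.

Lemma frame_lin k : linear_set (frame k).
Proof. exact: ends_lin. Qed.

Lemma frame_mono k : frame k `<=` frame k.+1.
Proof. by apply: ends_sub. Qed.

Lemma frame_add c k : frame k `<=` frame (k + c)%N.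
Proof. by apply: ends_sub; rewrite ltnS leq_addr. Qed.

Lemma frame_diff k v : frame k v -> frame k.+1 (D *m v).
Proof. by move=> /ends_diff; apply: ends_sub. Qed.

Lemma frame_diff_tr k v : frame k v -> frame k.+1 (D^T *m v).
Proof. by move=> /ends_diff_tr; apply: ends_sub. Qed.

Lemma frame_diff_diff k v : frame k v -> frame k.+1 (D^T *m (D *m v)).
Proof. by move=> /ends_diff /ends_diff_tr; apply: ends_sub. Qed.

Let rho0 : rho != 0. Proof. by rewrite gt_eqF //; case/andP: rho01. Qed.

Lemma gvec_diff : frame 0 (D *m g - (rho * w) *: g).
Proof.
have -> : rho * w = 1 - rho ^+ 2 by rewrite -rhoE; field.
by apply: (@ends_sub _ _ 0 1) => //; apply: diff_geo.
Qed.

Lemma gvec_diff_tr : frame 0 (D^T *m g + (w / rho) *: g).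
Proof.
have -> : w / rho = - (1 - (rho ^+ 2)^-1) by rewrite -rhoE; field.
by rewrite scaleNr; apply: diff_tr_geo; rewrite expf_neq0.
Qed.

Lemma gvec_diff_diff : frame 0 (D^T *m (D *m g) + w ^+ 2 *: g).
Proof.
have -> : w ^+ 2 = - ((1 - rho ^+ 2) * (1 - (rho ^+ 2)^-1)).
  by rewrite -rhoE; field.
by rewrite scaleNr; apply: diff_diff_geo; rewrite expf_neq0.
Qed.

Lemma gvec_gt0 : 0 < dot g g.
Proof.
rewrite lt0r dot_ge0 dot_eq0 andbT; apply/eqP => /colP /(_ ord0).
by rewrite !mxE expr0; apply/eqP; exact: oner_neq0.
Qed.

(** This is [geo_decay] with K = k + 1, which is at most a third of the path length 3 m + 3; rho^(4
    K) is then at least expR (-4 w K). *)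
Lemma frame_decay k X v : (k <= m)%N -> frame k v ->
  expR (- (4 * w * k.+1%:R)) / 3 * dot (X *: g) (X *: g) <=
  dot (v - X *: g) (v - X *: g).
Proof.
move=> km Vv; have /andP[r0 r1] := rho01.
have q01 : 0 <= rho ^+ 2 <= 1 by rewrite sqr_ge0 exprn_ile1 // ltW.
apply: le_trans (geo_decay X q01 _ Vv); last by lia.
rewrite ler_wpM2r ?dot_ge0 // ler_pM2r ?invr_gt0 // -!exprM.
have -> : - (4 * w * k.+1%:R) = - w * (2 * 2 * k.+1)%:R by rewrite !natrM; ring.
by rewrite expRM_natr mulnA ler_pXn2r ?nnegrE ?expR_ge0 ?(ltW r0) //.
Qed.

End chain.

(** * Hard instances for the gradient oracle *)

Lemma decay_comb (R : realType) (E a b c1 c2 d1 d2 : R) :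
  0 <= a -> 0 <= b -> E * c1 <= d1 -> E * c2 <= d2 ->
  E * (a * c1 + b * c2) <= a * d1 + b * d2.
Proof.
move=> a0 b0 h1 h2; rewrite mulrDr !(mulrCA E).
by apply: lerD; apply: ler_wpM2l.
Qed.

Lemma col_frame_decay (R : realType) m (w rho : R) k X Y v :
  0 < rho < 1 -> expR (- w) <= rho -> (k <= m)%N ->
  col_set (@frame R m k) (@frame R m k) v ->
  expR (- (4 * w * k.+1%:R)) / 3 *
    dot (col_mx (X *: gvec m rho) (Y *: gvec m rho))
        (col_mx (X *: gvec m rho) (Y *: gvec m rho)) <=
  dot (v - col_mx (X *: gvec m rho) (Y *: gvec m rho))
      (v - col_mx (X *: gvec m rho) (Y *: gvec m rho)).
Proof.
move=> rho01 rho_exp km [Vu Vd].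
rewrite -[v]vsubmxK opp_col_mx add_col_mx !dot_col_mx mulrDr.
by apply: lerD; apply: frame_decay.
Qed.

Section instances.
Variables (R : realType) (p : params R) (m : nat) (w rho : R).
Hypothesis padm : admissible p.
Hypotheses (rho01 : 0 < rho < 1) (rhoE : rho^-1 - rho = w).
Hypothesis rho_exp : expR (- w) <= rho.
Hypotheses (dx0 : 0 < deltax p) (dy0 : 0 < deltay p).

Local Notation N := (3 * m).+2.
Local Notation n := N.+1.
Local Notation D := (path_diff R N).
Local Notation g := (gvec m rho).
Local Notation frame := (@frame R m).

(** Since D^T D is at most 4, this weight keeps the Hessian between [mux] and [Lx]. *)
Let c := (Lx p - mux p) / 4.

Definition path_hessian : 'M[R]_n := (mux p)%:M + c *: (D^T *m D).

Let c0 : 0 <= c.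
Proof. by have [/andP[_ h] _ _ _ _] := padm; rewrite /c; lra. Qed.

Lemma path_hessianE (v : 'cV[R]_n) :
  path_hessian *m v = mux p *: v + c *: (D^T *m (D *m v)).
Proof. by rewrite mulmxDl mul_scalar_mx -scalemxAl mulmxA. Qed.

Lemma path_hessian_sym : path_hessian^T = path_hessian.
Proof. by rewrite linearD linearZ /= gram_sym tr_scalar_mx. Qed.

Lemma path_hessian_bounds u :
  mux p * dot u u <= dot u (path_hessian *m u) <= Lx p * dot u u.
Proof.
rewrite path_hessianE dotDr !dotZr mulmxA gram_form.
have := ler_wpM2l c0 (diff_bound u).
have := mulr_ge0 c0 (dot_ge0 (D *m u)); rewrite /c.
by move=> *; apply/andP; split; lra.
Qed.

Lemma path_hessian_frame k v : frame k v -> frame (k + 1)%N (path_hessian *m v).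
Proof.
move=> Vv; rewrite addn1 path_hessianE.
apply: (linear_setD (frame_lin _ _ _)); apply: (linear_setZ (frame_lin _ _ _)).
  exact: frame_mono.
exact: frame_diff_diff.
Qed.

Lemma path_hessian_gvec :
  frame 0 (path_hessian *m g - (mux p - c * w ^+ 2) *: g).
Proof.
have -> : path_hessian *m g - (mux p - c * w ^+ 2) *: g =
    c *: (D^T *m (D *m g) + w ^+ 2 *: g).
  rewrite path_hessianE scalerDr scalerA scalerBl opprB addrACA.
  by rewrite addrC addrA subrK addrC.
apply: (linear_setZ (frame_lin _ _ _)); exact: gvec_diff_diff.
Qed.

Lemma scalar_mx_bounds d (mu L s : R) (u : 'cV[R]_d) : mu <= s <= L ->
  mu * dot u u <= dot u (s%:M *m u) <= L * dot u u.
Proof.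
by move=> /andP[h1 h2]; rewrite mul_scalar_mx dotZr !ler_wpM2r ?dot_ge0.
Qed.

(** Stationarity in y gives y = (muxy / Ly) x, so x sees the curvature deltax + c D^T D. The
    geometric sequence is stationary inside the path when deltax = c w^2. *)
Lemma gradient_instance_coupled : 0 < muxy p ->
  w ^+ 2 = 4 * deltax p / (Lx p - mux p) ->
  chain_quad p true false false w m.
Proof.
move=> muxy0 w2.
have [/andP[mux0 hx] /andP[muy0 hy] /andP[_ hxy] /andP[muyx0 _] hmu] := padm.
have Ly0 : 0 < Ly p := le_lt_trans muy0 hy.
have gt0 := gvec_gt0 m rho.
apply: (@Build_chain_quad _ p true false false w m n n path_hessian (Ly p)%:M
  (muxy p)%:M (1 *: g) ((muxy p / Ly p) *: g) frame frame) => //.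
- have BB : (muxy p)%:M^T *m (muxy p)%:M = (muxy p ^+ 2)%:M :> 'M[R]_n.
    by rewrite tr_scalar_mx -scalar_mxM -expr2.
  split.
  + exact: path_hessian_sym.
  + exact: tr_scalar_mx.
  + exact: path_hessian_bounds.
  + by move=> v; apply: scalar_mx_bounds; rewrite lexx ltW.
  + move=> u; rewrite -gram_form BB mul_scalar_mx dotZr ler_wpM2r ?dot_ge0 //.
    by rewrite ler_pXn2r ?nnegrE //; lra.
  + by apply: lower_singular_isometry BB; rewrite lexx ltW.
  + apply: (lower_singular_isometry (mu := muxy p)).
      (* A positive [muyx] equals [muxy] by admissibility; otherwise it is 0 and below [muxy]. *)
      case: (ltP 0 (muyx p)) => [h|h]; first by rewrite hmu // lexx ltW.
      by rewrite muyx0 (le_trans h) // ltW.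
    by rewrite trmxK tr_scalar_mx -scalar_mxM -expr2.
- exact: frame_lin.
- exact: frame_lin.
- exact: frame_mono.
- exact: frame_mono.
- exact: path_hessian_frame.
- move=> k y Vy; rewrite addn0 mul_scalar_mx.
  by apply: (linear_setZ (frame_lin _ _ _)).
- move=> k y Vy; rewrite addn0 mul_scalar_mx.
  by apply: (linear_setZ (frame_lin _ _ _)).
- move=> k y Vy; rewrite addn0 tr_scalar_mx mul_scalar_mx.
  by apply: (linear_setZ (frame_lin _ _ _)).
- rewrite scale1r tr_scalar_mx mul_scalar_mx scalerA.
  suff -> : muxy p * (muxy p / Ly p) = - (mux p - c * w ^+ 2).
    by rewrite scaleNr; exact: path_hessian_gvec.
  by rewrite w2 /c /deltax; field; lra.
- rewrite scale1r !mul_scalar_mx scalerA.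
  have -> : Ly p * (muxy p / Ly p) = muxy p by field; lra.
  by rewrite subrr; case: (frame_lin R m 0).
- rewrite !dotZl !dotZr !mul1r ltr_wpDr //; last by rewrite mulr_gt0.
  by rewrite mulr_ge0 ?(ltW dy0) // mulrA -expr2 mulr_ge0 ?sqr_ge0 // ltW.
- move=> k x y km Vx Vy; apply: decay_comb; rewrite ?(ltW dx0) ?(ltW dy0) //.
    exact: frame_decay.
  exact: frame_decay.
Qed.

(** The path must not gain curvature from B, so B acts only on a second copy of the variables, where
    the solution vanishes; this copy gives B^T its singular value [muyx]. On the path the balance is
    mux = c w^2. *)
Lemma gradient_instance_decoupled : muxy p = 0 ->
  w ^+ 2 = 4 * deltax p / (Lx p - mux p) ->
  chain_quad p true false false w m.
Proof.
move=> muxy0 w2.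
have [/andP[mux0 hx] /andP[muy0 hy] /andP[_ hxy] /andP[muyx0 hyx] hmu] := padm.
have Ly0 : 0 < Ly p := le_lt_trans muy0 hy.
have gt0 := gvec_gt0 m rho.
pose A : 'M[R]_(n + n) := block_mx path_hessian 0 0 (Lx p)%:M.
pose B : 'M[R]_(n, n + n) := row_mx 0 (muyx p)%:M.
have AE u v : A *m col_mx u v = col_mx (path_hessian *m u) (Lx p *: v).
  by rewrite mul_block_col !mul0mx addr0 add0r mul_scalar_mx.
have BE u v : B *m col_mx u v = muyx p *: v.
  by rewrite mul_row_col mul0mx add0r mul_scalar_mx.
have BtE v : B^T *m v = col_mx 0 (muyx p *: v).
  by rewrite tr_row_mx trmx0 tr_scalar_mx mul_col_mx mul0mx mul_scalar_mx.
apply: (@Build_chain_quad _ p true false false w m (n + n) n A (Ly p)%:M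
  B (col_mx (1 *: g) (0 *: g)) (0 *: g)
  (fun k => col_set (frame k) (frame k)) frame) => //.
- split.
  + by rewrite tr_block_mx path_hessian_sym !trmx0 tr_scalar_mx.
  + exact: tr_scalar_mx.
  + move=> u; rewrite -[u]vsubmxK AE !dot_col_mx dotZr.
    have /andP[h1 h2] := path_hessian_bounds (usubmx u).
    have := ler_wpM2r (dot_ge0 (dsubmx u)) (ltW hx).
    by move=> h3; apply/andP; split; lra.
  + by move=> v; apply: scalar_mx_bounds; rewrite lexx ltW.
  + move=> u; rewrite -[u]vsubmxK BE dot_col_mx dotZl dotZr mulrA -expr2 mulrDr.
    apply: ler_wpDl; first by rewrite mulr_ge0 ?sqr_ge0 ?dot_ge0.
    rewrite ler_wpM2r ?dot_ge0 //.
    by rewrite ler_pXn2r ?nnegrE //; lra.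
  + split; last by left.
    by move=> u; rewrite muxy0 expr0n /= mul0r dot_ge0.
  + apply: (lower_singular_isometry (mu := muyx p)); first by rewrite lexx muyx0.
    rewrite trmxK tr_row_mx mul_row_col trmx0 mul0mx add0r tr_scalar_mx.
    by rewrite -scalar_mxM -expr2.
- by move=> k; apply: col_set_lin; exact: frame_lin.
- exact: frame_lin.
- by move=> k x [Vu Vd]; split; exact: frame_mono.
- exact: frame_mono.
- move=> k x [Vu Vd]; rewrite -[x]vsubmxK AE; apply: col_setE.
    exact: path_hessian_frame.
  by apply: (linear_setZ (frame_lin _ _ _)); exact: frame_add.
- move=> k y Vy; rewrite addn0 mul_scalar_mx.
  by apply: (linear_setZ (frame_lin _ _ _)).
- move=> k x [Vu Vd]; rewrite -[x]vsubmxK BE addn0.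
  by apply: (linear_setZ (frame_lin _ _ _)).
- move=> k y Vy; rewrite BtE addn0; apply: col_setE.
    by case: (frame_lin R m k).
  by apply: (linear_setZ (frame_lin _ _ _)).
- rewrite !scale0r scale1r AE mulmx0 scaler0 addr0; apply: col_setE; last first.
    by case: (frame_lin R m 0).
  suff z : mux p - c * w ^+ 2 = 0.
    by have := path_hessian_gvec; rewrite z scale0r subr0.
  by rewrite w2 /c /deltax muxy0; field; lra.
- rewrite BE !scale0r !scaler0 mulmx0 subr0.
  by case: (frame_lin R m 0).
- by rewrite !scale0r scale1r dot_col_mx !dot0l mulr0 !addr0 mulr_gt0.
- move=> k x y km Vx Vy; apply: decay_comb; rewrite ?(ltW dx0) ?(ltW dy0) //.
    exact: col_frame_decay.
  exact: frame_decay.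
Qed.

End instances.

(** * Hard instances for the coupling matrix *)

Section coupling_instances.
Variables (R : realType) (p : params R) (m : nat) (w rho : R).
Hypothesis padm : admissible p.
Hypotheses (rho01 : 0 < rho < 1) (rhoE : rho^-1 - rho = w).
Hypothesis rho_exp : expR (- w) <= rho.
Hypotheses (dx0 : 0 < deltax p) (dy0 : 0 < deltay p).

Local Notation N := (3 * m).+2.
Local Notation n := N.+1.
Local Notation g := (gvec m rho).
Local Notation frame := (@frame R m).

(** With this factor K^T K is at most (4/9) Lxy^2, which leaves (5/9) Lxy^2 for the diagonal part of
    B^T B. *)
Let kap := Lxy p / 3.
Let K : 'M[R]_n := kap *: path_diff R N.
Let h := kap * w.

Let rho0 : rho != 0. Proof. by rewrite gt_eqF //; case/andP: rho01. Qed.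

Let KE (v : 'cV[R]_n) : K *m v = kap *: (path_diff R N *m v).
Proof. by rewrite -scalemxAl. Qed.

Let KtE (v : 'cV[R]_n) : K^T *m v = kap *: ((path_diff R N)^T *m v).
Proof. by rewrite linearZ /= -scalemxAl. Qed.

Lemma coupling_bound (u : 'cV[R]_n) :
  dot (K *m u) (K *m u) <= (4 / 9 * Lxy p ^+ 2) * dot u u.
Proof.
rewrite KE dotZl dotZr mulrA.
have := ler_wpM2l (sqr_ge0 kap) (diff_bound u); rewrite /kap; lra.
Qed.

Lemma coupling_frame k v : frame k v -> frame (k + 1)%N (K *m v).
Proof.
move=> Vv; rewrite addn1 KE; apply: (linear_setZ (frame_lin _ _ _)).
exact: frame_diff.
Qed.

Lemma coupling_tr_frame k v : frame k v -> frame (k + 1)%N (K^T *m v).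
Proof.
move=> Vv; rewrite addn1 KtE; apply: (linear_setZ (frame_lin _ _ _)).
exact: frame_diff_tr.
Qed.

Lemma coupling_gvec : frame 0 (K *m g - (rho * h) *: g).
Proof.
have -> : K *m g - (rho * h) *: g =
    kap *: (path_diff R N *m g - (rho * w) *: g).
  by rewrite KE scalerBr scalerA /h mulrCA.
by apply: (linear_setZ (frame_lin _ _ _)); apply: gvec_diff.
Qed.

Lemma coupling_tr_gvec : frame 0 (K^T *m g + (h / rho) *: g).
Proof.
have -> : K^T *m g + (h / rho) *: g =
    kap *: ((path_diff R N)^T *m g + (w / rho) *: g).
  by rewrite KtE scalerDr scalerA /h mulrA.
by apply: (linear_setZ (frame_lin _ _ _)); apply: gvec_diff_tr.
Qed.

Let frame0 k : frame k 0. Proof. by case: (frame_lin R m k). Qed.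

Let frameZ k a v : frame k v -> frame k (a *: v).
Proof. exact: (linear_setZ (frame_lin _ _ _)). Qed.

Let frameD k u v : frame k u -> frame k v -> frame k (u + v).
Proof. exact: (linear_setD (frame_lin _ _ _)). Qed.

Let frameN k v : frame k v -> frame k (- v).
Proof. exact: (linear_setN (frame_lin _ _ _)). Qed.

(** Eliminating the stiff y1 turns the curvature of x into deltax, while y2 has curvature muy =
    deltay. On the geometric sequence K and K^T act as rho h and -h / rho, which gives the balance
    h^2 = deltax deltay. *)
Lemma coupling_instance_onesided : muyx p = 0 -> 3 * muxy p <= Lxy p ->
  h ^+ 2 = deltax p * deltay p ->
  chain_quad p false false true w m.
Proof.
move=> muyx0 hxy h2.
have [/andP[mux0 hx] /andP[muy0 hy] /andP[muxy0 Lxy0] _ _] := padm.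
have Ly0 : 0 < Ly p := le_lt_trans muy0 hy.
have dyE : deltay p = muy p by rewrite /deltay muyx0 expr0n /= mul0r addr0.
have muy_gt0 : 0 < muy p by rewrite -dyE.
have gt0 := gvec_gt0 m rho.
pose G : 'M[R]_(n + n) := block_mx (Ly p)%:M 0 0 (muy p)%:M.
pose B : 'M[R]_(n + n, n) := col_mx (muxy p)%:M K.
have GE u v : G *m col_mx u v = col_mx (Ly p *: u) (muy p *: v).
  by rewrite mul_block_col !mul0mx addr0 add0r !mul_scalar_mx.
have BE u : B *m u = col_mx (muxy p *: u) (K *m u).
  by rewrite mul_col_mx mul_scalar_mx.
have BtE u v : B^T *m col_mx u v = muxy p *: u + K^T *m v.
  by rewrite tr_col_mx mul_row_col tr_scalar_mx mul_scalar_mx.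
have BB u : dot (B *m u) (B *m u) = muxy p ^+ 2 * dot u u + dot (K *m u) (K *m u).
  by rewrite BE dot_col_mx dotZl dotZr mulrA -expr2.
apply: (@Build_chain_quad _ p false false true w m n (n + n) (mux p)%:M G B
  (1 *: g) (col_mx ((muxy p / Ly p) *: g) ((rho * h / muy p) *: g))
  frame (fun k => col_set (frame k) (frame k))) => //.
- split.
  + exact: tr_scalar_mx.
  + by rewrite tr_block_mx !trmx0 !tr_scalar_mx.
  + by move=> u; apply: scalar_mx_bounds; rewrite lexx ltW.
  + move=> u; rewrite -[u]vsubmxK GE !dot_col_mx !dotZr.
    have := ler_wpM2r (dot_ge0 (usubmx u)) (ltW hy).
    have := ler_wpM2r (dot_ge0 (dsubmx u)) (ltW hy).
    by move=> *; apply/andP; split; lra.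
  + move=> u; rewrite BB.
    have := coupling_bound u.
    have : muxy p ^+ 2 <= 5 / 9 * Lxy p ^+ 2 by nra.
    by move/(ler_wpM2r (dot_ge0 u)); lra.
  + split; first by move=> u; rewrite BB lerDl dot_ge0.
    have [muxy_gt0|] := ltP 0 (muxy p); last first.
      by move=> muxy_le0; left; apply/le_anti; rewrite muxy_le0.
    (* K kills constant vectors, so they attain the eigenvalue muxy^2 of B^T B. *)
    right; exists (muxy p ^+ 2); first exact: exprn_gt0.
    exists (const_mx 1).
      apply/eqP => /colP /(_ ord0); rewrite !mxE; apply/eqP; exact: oner_neq0.
    by rewrite BE KE diff_const scaler0 BtE mulmx0 addr0 scalerA.
  + split; last by left.
    by move=> u; rewrite muyx0 expr0n /= mul0r dot_ge0.
- exact: frame_lin.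
- by move=> k; apply: col_set_lin; exact: frame_lin.
- exact: frame_mono.
- by move=> k x [Vu Vd]; split; exact: frame_mono.
- by move=> k x Vx; rewrite addn0 mul_scalar_mx; exact: frameZ.
- move=> k x [Vu Vd]; rewrite addn0 -[x]vsubmxK GE.
  by apply: col_setE; exact: frameZ.
- move=> k x Vx; rewrite BE; apply: col_setE; last exact: coupling_frame.
  by apply: frameZ; exact: frame_add.
- move=> k x [Vu Vd]; rewrite -[x]vsubmxK BtE.
  apply: frameD; last exact: coupling_tr_frame.
  by apply: frameZ; exact: frame_add.
- rewrite scale1r mul_scalar_mx BtE -scalemxAr.
  have -> : mux p *: g + (muxy p *: ((muxy p / Ly p) *: g) +
      (rho * h / muy p) *: (K^T *m g)) =
      (rho * h / muy p) *: (K^T *m g + (h / rho) *: g).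
    rewrite addrA addrC scalerDr scalerA; congr (_ + _).
    rewrite scalerA -scalerDl; congr (_ *: _).
    have -> : mux p + muxy p * (muxy p / Ly p) = deltax p by rewrite /deltax; ring.
    have -> : rho * h / muy p * (h / rho) = h ^+ 2 / muy p by field; rewrite rho0 gt_eqF.
    by rewrite h2 dyE mulfK // gt_eqF.
  by apply: frameZ; exact: coupling_tr_gvec.
- rewrite scale1r GE BE opp_col_mx add_col_mx !scalerA; apply: col_setE.
    have -> : Ly p * (muxy p / Ly p) = muxy p by field; rewrite gt_eqF.
    by rewrite subrr; exact: frame0.
  have -> : muy p * (rho * h / muy p) = rho * h by field; rewrite gt_eqF.
  by rewrite -opprB; apply: frameN; exact: coupling_gvec.
- rewrite scale1r ltr_wpDr //; last by rewrite mulr_gt0.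
  by rewrite mulr_ge0 ?(ltW dy0) ?dot_ge0.
- move=> k x y km Vx Vy; apply: decay_comb; rewrite ?(ltW dx0) ?(ltW dy0) //.
    exact: frame_decay.
  exact: col_frame_decay.
Qed.

(** Put M = Lx Ly - s. Eliminating y1 and x2 leaves (mux + mu^2 Lx / M) X1 = h (1 + mu^2 / M) Y2 and
    (muy + mu^2 Ly / M) Y2 = h (1 + mu^2 / M) X1. The last hypothesis says that this system is
    singular. *)
Lemma coupling_instance_twosided (s : R) : 0 < muxy p -> muyx p = muxy p ->
  3 * muxy p <= Lxy p -> h ^+ 2 = s -> 0 < Lx p * Ly p - s ->
  (mux p * (Lx p * Ly p - s) + muxy p ^+ 2 * Lx p) *
    (muy p * (Lx p * Ly p - s) + muxy p ^+ 2 * Ly p) =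
    s * (Lx p * Ly p - s + muxy p ^+ 2) ^+ 2 ->
  chain_quad p false false true w m.
Proof.
move=> mu0 muE hxy h2 N0 sE.
have [/andP[mux0 hx] /andP[muy0 hy] /andP[_ Lxy0] _ _] := padm.
have Ly0 : 0 < Ly p := le_lt_trans muy0 hy.
have Lx0 : 0 < Lx p := le_lt_trans mux0 hx.
have gt0 := gvec_gt0 m rho.
set mu := muxy p in mu0 muE hxy sE *.
set M := Lx p * Ly p - s in N0 sE.
pose Q := muy p * M + mu ^+ 2 * Ly p.
have Q0 : 0 < Q.
  by rewrite ltr_wpDl // ?mulr_gt0 ?exprn_gt0 // mulr_ge0 // ltW.
pose A : 'M[R]_(n + n) := block_mx (mux p)%:M 0 0 (Lx p)%:M.
pose G : 'M[R]_(n + n) := block_mx (Ly p)%:M 0 0 (muy p)%:M.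
pose B : 'M[R]_(n + n) := block_mx mu%:M (- K^T) K mu%:M.
have AE u v : A *m col_mx u v = col_mx (mux p *: u) (Lx p *: v).
  by rewrite mul_block_col !mul0mx addr0 add0r !mul_scalar_mx.
have GE u v : G *m col_mx u v = col_mx (Ly p *: u) (muy p *: v).
  by rewrite mul_block_col !mul0mx addr0 add0r !mul_scalar_mx.
have BE u v : B *m col_mx u v = col_mx (mu *: u - K^T *m v) (K *m u + mu *: v).
  by rewrite mul_block_col !mul_scalar_mx mulNmx.
have BtE u v : B^T *m col_mx u v = col_mx (mu *: u + K^T *m v) (mu *: v - K *m u).
  rewrite tr_block_mx !tr_scalar_mx linearN /= trmxK mul_block_col.
  by rewrite !mul_scalar_mx mulNmx (addrC (- _)).
have BB u v : dot (B *m col_mx u v) (B *m col_mx u v) =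
    mu ^+ 2 * (dot u u + dot v v) + dot (K *m u) (K *m u) + dot (K^T *m v) (K^T *m v).
  rewrite BE dot_col_mx !(dotDl, dotDr, dotNl, dotNr, dotZl, dotZr).
  have -> : dot u (K^T *m v) = dot v (K *m u) by rewrite dotC dot_tr.
  have -> : dot (K^T *m v) u = dot v (K *m u) by rewrite -dot_tr.
  rewrite (dotC (K *m u) v); ring.
have BtB u v : dot (B^T *m col_mx u v) (B^T *m col_mx u v) =
    mu ^+ 2 * (dot u u + dot v v) + dot (K *m u) (K *m u) + dot (K^T *m v) (K^T *m v).
  rewrite BtE dot_col_mx !(dotDl, dotDr, dotNl, dotNr, dotZl, dotZr).
  have -> : dot u (K^T *m v) = dot v (K *m u) by rewrite dotC dot_tr.
  have -> : dot (K^T *m v) u = dot v (K *m u) by rewrite -dot_tr.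
  rewrite (dotC (K *m u) v); ring.
(* K kills constants, so [o] is an eigenvector of both Gram matrices, with eigenvalue mu^2. *)
pose o : 'cV[R]_(n + n) := col_mx (const_mx 1) 0.
have o_neq0 : o != 0.
  rewrite col_mx_eq0 negb_and; apply/orP; left.
  by apply/eqP => /colP /(_ ord0); rewrite !mxE; apply/eqP; exact: oner_neq0.
have Ko : K *m const_mx 1 = 0 :> 'cV[R]_n by rewrite KE diff_const scaler0.
have oE : B^T *m (B *m o) = mu ^+ 2 *: o.
  rewrite BE Ko mulmx0 scaler0 addr0 subr0 BtE mulmx0 addr0 scaler0.
  by rewrite -scalemxAr Ko scaler0 subr0 scalerA scale_col_mx scaler0.
have oE' : B *m (B^T *m o) = mu ^+ 2 *: o.
  rewrite BtE Ko mulmx0 scaler0 addr0 subr0 BE mulmx0 subr0 scaler0 addr0.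
  by rewrite -scalemxAr Ko scaler0 scalerA scale_col_mx scaler0.
(* The amplitudes solve the four stationarity equations of the ansatz
   [x1 = X1 g], [x2 = rho X2 g], [y1 = Y1 g], [y2 = rho Y2 g]; the last
   equation is the determinant condition [sE]. *)
pose X1 := Q * M.
pose Y2 := h * (M + mu ^+ 2) * M.
pose Y1 := mu * (Lx p * Q - s * (M + mu ^+ 2)).
pose X2 := mu * h * (Q - Ly p * (M + mu ^+ 2)).
apply: (@Build_chain_quad _ p false false true w m (n + n) (n + n) A G B
  (col_mx (X1 *: g) ((rho * X2) *: g)) (col_mx (Y1 *: g) ((rho * Y2) *: g))
  (fun k => col_set (frame k) (frame k)) (fun k => col_set (frame k) (frame k))) => //.
- split.
  + by rewrite tr_block_mx !trmx0 !tr_scalar_mx.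
  + by rewrite tr_block_mx !trmx0 !tr_scalar_mx.
  + move=> u; rewrite -[u]vsubmxK AE !dot_col_mx !dotZr.
    have := ler_wpM2r (dot_ge0 (usubmx u)) (ltW hx).
    have := ler_wpM2r (dot_ge0 (dsubmx u)) (ltW hx).
    by move=> *; apply/andP; split; lra.
  + move=> u; rewrite -[u]vsubmxK GE !dot_col_mx !dotZr.
    have := ler_wpM2r (dot_ge0 (usubmx u)) (ltW hy).
    have := ler_wpM2r (dot_ge0 (dsubmx u)) (ltW hy).
    by move=> *; apply/andP; split; lra.
  + move=> u; rewrite -[u]vsubmxK BB dot_col_mx.
    have h1 := coupling_bound (usubmx u).
    have h2' : dot (K^T *m dsubmx u) (K^T *m dsubmx u) <=
        4 / 9 * Lxy p ^+ 2 * dot (dsubmx u) (dsubmx u).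
      apply: mulmx_tr_bound; last exact: coupling_bound.
      by rewrite mulr_gt0 // exprn_gt0 // (lt_trans mu0).
    have : mu ^+ 2 <= 5 / 9 * Lxy p ^+ 2 by nra.
    move/(ler_wpM2r (addr_ge0 (dot_ge0 (usubmx u)) (dot_ge0 (dsubmx u)))).
    lra.
  + split; last by right; exists (mu ^+ 2); [exact: exprn_gt0|exists o].
    move=> u; rewrite -[u]vsubmxK BB dot_col_mx -addrA lerDl.
    by rewrite addr_ge0 ?dot_ge0.
  + rewrite muE; split; last first.
      right; exists (mu ^+ 2); first exact: exprn_gt0.
      by exists o => //; rewrite trmxK.
    move=> u; rewrite -[u]vsubmxK BtB dot_col_mx -addrA lerDl.
    by rewrite addr_ge0 ?dot_ge0.
- by move=> k; apply: col_set_lin; exact: frame_lin.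
- by move=> k; apply: col_set_lin; exact: frame_lin.
- by move=> k x [Vu Vd]; split; exact: frame_mono.
- by move=> k x [Vu Vd]; split; exact: frame_mono.
- move=> k x [Vu Vd]; rewrite addn0 -[x]vsubmxK AE.
  by apply: col_setE; exact: frameZ.
- move=> k x [Vu Vd]; rewrite addn0 -[x]vsubmxK GE.
  by apply: col_setE; exact: frameZ.
- move=> k x [Vu Vd]; rewrite -[x]vsubmxK BE; apply: col_setE; apply: frameD.
  + by apply: frameZ; exact: frame_add.
  + by apply: frameN; exact: coupling_tr_frame.
  + exact: coupling_frame.
  + by apply: frameZ; exact: frame_add.
- move=> k x [Vu Vd]; rewrite -[x]vsubmxK BtE; apply: col_setE; apply: frameD.
  + by apply: frameZ; exact: frame_add.
  + exact: coupling_tr_frame.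
  + by apply: frameZ; exact: frame_add.
  + by apply: frameN; exact: coupling_frame.
- rewrite AE BtE add_col_mx -!scalemxAr !scalerA; apply: col_setE.
    have -> : (mux p * X1) *: g + ((mu * Y1) *: g + (rho * Y2) *: (K^T *m g)) =
        (rho * Y2) *: (K^T *m g + (h / rho) *: g).
      rewrite addrA addrC scalerDr scalerA -scalerDl; congr (_ + _ *: _).
      have -> : rho * Y2 * (h / rho) = s * (M + mu ^+ 2) * M.
        by rewrite /Y2 -h2; field.
      have e1 := sE; rewrite -/Q in e1.
      have -> : mux p * X1 + mu * Y1 =
        (mux p * M + mu ^+ 2 * Lx p) * Q - s * (M + mu ^+ 2) * mu ^+ 2.
        by rewrite /X1 /Y1; ring.
      by rewrite e1; ring.
    by apply: frameZ; exact: coupling_tr_gvec.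
  have -> : (Lx p * (rho * X2)) *: g + ((mu * (rho * Y2)) *: g - Y1 *: (K *m g)) =
      - Y1 *: (K *m g - (rho * h) *: g).
    rewrite scalerBr addrA [LHS]addrC -scaleNr scalerA -scaleNr -scalerDl.
    congr (_ + _ *: _); rewrite /X2 /Y1 /Y2 /M; ring.
  by apply: frameZ; exact: coupling_gvec.
- rewrite GE BE opp_col_mx add_col_mx -!scalemxAr !scalerA; apply: col_setE.
    have -> : (Ly p * Y1) *: g - ((mu * X1) *: g - (rho * X2) *: (K^T *m g)) =
        (rho * X2) *: (K^T *m g + (h / rho) *: g).
      rewrite opprB addrCA -scalerBl scalerDr scalerA; congr (_ + _ *: _).
      have -> : rho * X2 * (h / rho) = mu * s * (Q - Ly p * (M + mu ^+ 2)).
        by rewrite /X2 -h2; field.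
      rewrite /Y1 /X1 /M; ring.
    by apply: frameZ; exact: coupling_tr_gvec.
  have -> : (muy p * (rho * Y2)) *: g - (X1 *: (K *m g) + (mu * (rho * X2)) *: g) =
      - X1 *: (K *m g - (rho * h) *: g).
    rewrite opprD addrA scalerBr addrAC -scalerBl [LHS]addrC -scaleNr scalerA -scaleNr.
    congr (_ + _ *: _); rewrite /X2 /X1 /Y2 /Q; ring.
  by apply: frameZ; exact: coupling_gvec.
- apply: ltr_wpDr; first by rewrite mulr_ge0 ?(ltW dy0) ?dot_ge0.
  rewrite dot_col_mx mulr_gt0 // ltr_wpDr ?dot_ge0 //.
  by rewrite dotZl dotZr mulrA -expr2 mulr_gt0 // exprn_gt0 // mulr_gt0.
- move=> k x y km Vx Vy; apply: decay_comb; rewrite ?(ltW dx0) ?(ltW dy0) //.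
    exact: col_frame_decay.
  exact: col_frame_decay.
Qed.

End coupling_instances.

(** * Lower bounds *)

Section rates.
Variable R : realType.

(** The decay rate w is of order at most 1 / sqrt kappa. Every m is required because the path length
    is chosen after the accuracy. *)
Definition hard_ratio (p : params R) (cf cg cB : bool) (kappa : R) : Prop :=
  exists w : R, [/\ 0 < w <= 2, w * Num.sqrt kappa <= 6 &
    forall m, inhabited (chain_quad p cf cg cB w m)].

Lemma hard_le p (r eps tf tg tB T T' : R) : T' <= Num.max T 0 ->
  hard p r eps tf tg tB T -> hard p r eps tf tg tB T'.
Proof.
move=> TT [dx [dy [f [g [B [dx0 [dy0 [reg [Rr meth]]]]]]]]].
exists dx, dy, f, g, B; do 4!split=> //.
move=> Mx My xo yo /meth low t t0 Rt; apply: le_trans TT _.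
by rewrite ge_max t0 andbT; apply: low.
Qed.

Lemma ratio_hard p cf cg cB kappa (r eps tf tg tB tau T : R) :
  hard_ratio p cf cg cB kappa ->
  admissible p -> 0 < deltax p -> 0 < deltay p ->
  0 < r -> 0 < eps -> 0 < tf -> 0 < tg -> 0 < tB -> 0 < tau ->
  (cf -> tau <= tf) -> (cg -> tau <= tg) -> (cB -> tau <= tB) ->
  T <= tau * Num.sqrt kappa * ln (expR (- 8) / 3 * r ^+ 2 / eps) / 24 ->
  hard p r eps tf tg tB T.
Proof.
move=> [w [w02 wk q]] padm dx0 dy0 r0 e0 tf0 tg0 tB0 tau0 hf hg hB TL.
set L := ln _ in TL.
pose T0 := tau / (4 * w) * L.
have [q'] := q (Num.truncn (T0 / tau)).+1.
apply: (hard_le (T := T0)); last first.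
  apply: (chain_hard q') => //; rewrite -ler_pdivrMr //.
  by apply/ltW/truncnS_gt.
have w0 : 0 < w by case/andP: w02.
apply: le_trans TL _; rewrite le_max.
(* For L >= 0 the bound w sqrt kappa <= 6 explains the denominator 24 = 4 x 6. For L < 0 the claimed
   bound is at most 0. *)
have [L0|L0] := leP 0 L; apply/orP; [left|right].
  have -> : T0 = tau * L / (4 * w) by rewrite /T0 mulrAC.
  rewrite ler_pdivlMr ?mulr_gt0 //.
  have := ler_wpM2l (mulr_ge0 (ltW tau0) L0) wk; lra.
rewrite -mulrA nmulr_lle0; last by rewrite pmulr_llt0 ?invr_gt0.
by rewrite mulr_ge0 ?sqrtr_ge0 // ltW.
Qed.

Lemma hard_ratio_swap p cf cg cB kappa : 0 < Lxy p ->
  hard_ratio p cf cg cB kappa -> hard_ratio (swap_params p) cg cf cB kappa.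
Proof.
move=> L0 [w [w02 wk q]]; exists w; split=> // m.
by have [q'] := q m; constructor; apply: chain_swap.
Qed.

Lemma swap_paramsK : involutive (@swap_params R).
Proof. by case. Qed.

Lemma admissible_swap (p : params R) : admissible p -> admissible (swap_params p).
Proof.
by case=> h1 h2 h3 h4 h5; split=> //= a b; rewrite h5.
Qed.

Lemma kappaxy_swap (p : params R) : kappaxy (swap_params p) = kappaxy p.
Proof. by rewrite /kappaxy mulrC [in RHS]mulrC [deltax p * _]mulrC. Qed.

(** From deltax <= (5/16) Lx and Lx - mux >= (3/4) Lx one gets w^2 <= 5/3 and w^2 kappax <= 16/3. *)
Lemma gradient_ratio (p : params R) : admissible p -> 4 * mux p < Lx p ->
  16 * muxy p ^+ 2 <= Lx p * Ly p -> 0 < deltax p -> 0 < deltay p ->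
  hard_ratio p true false false (kappax p).
Proof.
move=> padm mux4 hxy dx0 dy0.
have [/andP[mux0 hx] /andP[muy0 hy] /andP[muxy0 _] _ _] := padm.
have Ly0 : 0 < Ly p := le_lt_trans muy0 hy.
have Lx0 : 0 < Lx p := le_lt_trans mux0 hx.
have d0 : 0 < Lx p - mux p by rewrite subr_gt0.
have dx_ub : 16 * deltax p <= 5 * Lx p.
  have : muxy p ^+ 2 / Ly p <= Lx p / 16 by rewrite ler_pdivrMr //; lra.
  rewrite /deltax; lra.
pose w := Num.sqrt (4 * deltax p / (Lx p - mux p)).
have w0 : 0 < w by rewrite sqrtr_gt0 divr_gt0 // mulr_gt0.
have w2 : w ^+ 2 = 4 * deltax p / (Lx p - mux p).
  by rewrite sqr_sqrtr // divr_ge0 ?mulr_ge0 // ltW.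
exists w; split.
- rewrite w0 /= -(ler_pXn2r (_ : 0 < 2)%N) ?nnegrE ?(ltW w0) // w2.
  by rewrite ler_pdivrMr //; lra.
- rewrite -(ler_pXn2r (_ : 0 < 2)%N) ?nnegrE ?(mulr_ge0 (ltW w0) (sqrtr_ge0 _)) //.
  rewrite exprMn w2 sqr_sqrtr /kappax; last by rewrite divr_ge0 // ltW.
  have -> : 4 * deltax p / (Lx p - mux p) * (Lx p / deltax p) =
    4 * Lx p / (Lx p - mux p) by field; rewrite !gt_eqF.
  by rewrite ler_pdivrMr //; lra.
- move=> m; have [rho [rho01 rhoE rho_exp]] := rho_exists w0.
  constructor; have [muxy_gt0|muxy_le0] := ltP 0 (muxy p).
    exact: (gradient_instance_coupled _ padm rho01 rhoE rho_exp).
  apply: (gradient_instance_decoupled _ padm rho01 rhoE rho_exp) => //.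
  by apply/le_anti; rewrite muxy_le0.
Qed.

(** Intermediate value theorem for the difference of the two sides. At s = 0 it equals -(Lx Ly)^2
    delta. At s = 4 delta one still has Lx Ly - s >= Lx Ly / 2, so the cubic side is at least (Lx
    Ly)^2 delta, which dominates the other side. *)
Lemma determinant_root (Lx Ly mux muy mu : R) :
  0 <= mux -> 0 <= muy -> 0 < Lx -> 0 < Ly ->
  let delta := (mux + mu ^+ 2 / Ly) * (muy + mu ^+ 2 / Lx) in
  0 < delta -> 8 * delta <= Lx * Ly ->
  exists s, [/\ 0 < s, s <= 4 * delta &
    (mux * (Lx * Ly - s) + mu ^+ 2 * Lx) * (muy * (Lx * Ly - s) + mu ^+ 2 * Ly) =
    s * (Lx * Ly - s + mu ^+ 2) ^+ 2].
Proof.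
move=> mux0 muy0 Lx0 Ly0 delta d0 dub.
have LL0 : 0 < Lx * Ly by rewrite mulr_gt0.
pose M : {poly R} := (Lx * Ly)%:P - 'X.
pose P : {poly R} := 'X * (M + (mu ^+ 2)%:P) ^+ 2 -
  (mux%:P * M + (mu ^+ 2 * Lx)%:P) * (muy%:P * M + (mu ^+ 2 * Ly)%:P).
have PE s : P.[s] = s * (Lx * Ly - s + mu ^+ 2) ^+ 2 -
  (mux * (Lx * Ly - s) + mu ^+ 2 * Lx) * (muy * (Lx * Ly - s) + mu ^+ 2 * Ly).
  by rewrite /P /M !hornerE.
have deltaE : (mux * (Lx * Ly) + mu ^+ 2 * Lx) * (muy * (Lx * Ly) + mu ^+ 2 * Ly) =
    (Lx * Ly) ^+ 2 * delta.
  by rewrite /delta; field; rewrite !gt_eqF.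
clearbody delta; have P0 : P.[0] < 0.
  by rewrite PE mul0r sub0r subr0 deltaE oppr_lt0 mulr_gt0 // exprn_gt0.
have P4 : 0 <= P.[4 * delta].
  rewrite PE subr_ge0.
  have M0 : 0 <= Lx * Ly - 4 * delta by lra.
  have Mh : Lx * Ly / 2 <= Lx * Ly - 4 * delta + mu ^+ 2.
    by have := sqr_ge0 mu; lra.
  apply: (@le_trans _ _ ((Lx * Ly) ^+ 2 * delta)).
    have mx : 0 <= mu ^+ 2 * Lx by rewrite mulr_ge0 ?sqr_ge0 // ltW.
    have my : 0 <= mu ^+ 2 * Ly by rewrite mulr_ge0 ?sqr_ge0 // ltW.
    have MLL : Lx * Ly - 4 * delta <= Lx * Ly by lra.
    rewrite -deltaE; apply: ler_pM.
    - by rewrite addr_ge0 // mulr_ge0.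
    - by rewrite addr_ge0 // mulr_ge0.
    - by rewrite lerD2r ler_wpM2l.
    - by rewrite lerD2r ler_wpM2l.
  have -> : (Lx * Ly) ^+ 2 * delta = 4 * delta * (Lx * Ly / 2) ^+ 2 by field.
  rewrite ler_pM2l ?mulr_gt0 // ler_pXn2r ?nnegrE ?divr_ge0 ?(ltW LL0) //.
  by apply: le_trans Mh; rewrite divr_ge0 ?(ltW LL0).
have [||s /andP[s0 s4] /rootP Ps] := @poly_ivt _ P 0 (4 * delta) _ _.
- by rewrite mulr_ge0 // ltW.
- by rewrite ltW.
exists s; split=> //.
  rewrite lt0r s0 andbT; apply/eqP => z; move: P0 Ps; rewrite z => P0 Ps.
  by rewrite Ps ltxx in P0.
by apply/eqP; rewrite eq_sym -subr_eq0 -PE Ps.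
Qed.

(** The rate w = 3 h / Lxy inverts h = (Lxy / 3) w. The bound on h^2 gives w^2 kappaxy <= 36, the
    source of the constant 6 in [hard_ratio]. *)
Lemma coupling_ratio_of (p : params R) (h : R) : admissible p -> 0 < deltax p -> 0 < deltay p ->
  9 * (deltax p * deltay p) <= Lxy p ^+ 2 ->
  0 < h -> h ^+ 2 <= 4 * (deltax p * deltay p) ->
  (forall m rho, 0 < rho < 1 -> rho^-1 - rho = 3 * h / Lxy p ->
     expR (- (3 * h / Lxy p)) <= rho ->
     chain_quad p false false true (3 * h / Lxy p) m) ->
  hard_ratio p false false true (kappaxy p).
Proof.
move=> padm dx0 dy0 dub h0 h2 inst.
have [_ _ /andP[muxy0 hxy] _ _] := padm.
have L0 : 0 < Lxy p := le_lt_trans muxy0 hxy.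
have dd0 : 0 < deltax p * deltay p by rewrite mulr_gt0.
set w := 3 * h / Lxy p in inst *.
have w0 : 0 < w by rewrite divr_gt0 // mulr_gt0.
have w2 : w ^+ 2 = 9 * h ^+ 2 / Lxy p ^+ 2.
  by rewrite /w; field; rewrite gt_eqF.
exists w; split.
- rewrite w0 /= -(ler_pXn2r (_ : 0 < 2)%N) ?nnegrE ?(ltW w0) // w2.
  by rewrite ler_pdivrMr ?exprn_gt0 //; lra.
- rewrite -(ler_pXn2r (_ : 0 < 2)%N) ?nnegrE ?(mulr_ge0 (ltW w0) (sqrtr_ge0 _)) //.
  rewrite exprMn w2 sqr_sqrtr /kappaxy; last by rewrite divr_ge0 ?sqr_ge0 // ltW.
  have -> : 9 * h ^+ 2 / Lxy p ^+ 2 * (Lxy p ^+ 2 / (deltax p * deltay p)) =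
    9 * h ^+ 2 / (deltax p * deltay p) by field; rewrite !gt_eqF.
  by rewrite ler_pdivrMr //; lra.
- move=> m; have [rho [rho01 rhoE rho_exp]] := rho_exists w0.
  by constructor; apply: (inst m rho).
Qed.

Lemma coupling_ratio_onesided (p : params R) : admissible p -> muyx p = 0 ->
  3 * muxy p <= Lxy p -> 0 < deltax p -> 0 < deltay p ->
  9 * (deltax p * deltay p) <= Lxy p ^+ 2 ->
  hard_ratio p false false true (kappaxy p).
Proof.
move=> padm muyx0 hxy dx0 dy0 dub.
have dd0 : 0 < deltax p * deltay p by rewrite mulr_gt0.
have [_ _ /andP[muxy0 hL] _ _] := padm.
have h2 : Num.sqrt (deltax p * deltay p) ^+ 2 = deltax p * deltay p.
  by rewrite sqr_sqrtr // ltW.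
apply: (@coupling_ratio_of p (Num.sqrt (deltax p * deltay p))) => //.
- by rewrite sqrtr_gt0.
- by rewrite h2; lra.
- move=> m rho rho01 rhoE rho_exp.
  apply: (coupling_instance_onesided _ padm rho01 rhoE rho_exp) => //.
  rewrite -[RHS]h2; congr (_ ^+ 2); field.
  by rewrite gt_eqF // (le_lt_trans muxy0).
Qed.

Lemma coupling_ratio (p : params R) : admissible p ->
  4 * mux p < Lx p -> 4 * muy p < Ly p ->
  18 * muxy p <= Lxy p -> 18 * muyx p <= Lxy p ->
  324 * (mux p * muy p) <= Lxy p ^+ 2 ->
  16 * muxy p ^+ 2 <= Lx p * Ly p -> 16 * muyx p ^+ 2 <= Lx p * Ly p ->
  0 < deltax p -> 0 < deltay p ->
  hard_ratio p false false true (kappaxy p).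
Proof.
move=> padm mux4 muy4 hxy hyx hm cxy cyx dx0 dy0.
have [/andP[mux0 hx] /andP[muy0 hy] /andP[muxy0 hL] /andP[muyx0 _] hmu] := padm.
have L0 : 0 < Lxy p := le_lt_trans muxy0 hL.
have Ly0 : 0 < Ly p := le_lt_trans muy0 hy.
have Lx0 : 0 < Lx p := le_lt_trans mux0 hx.
set a := muxy p ^+ 2 / Ly p; set b := muyx p ^+ 2 / Lx p.
have aE : a * Ly p = muxy p ^+ 2 by rewrite divfK // gt_eqF.
have bE : b * Lx p = muyx p ^+ 2 by rewrite divfK // gt_eqF.
have a0 : 0 <= a by rewrite divr_ge0 ?sqr_ge0 // ltW.
have b0 : 0 <= b by rewrite divr_ge0 ?sqr_ge0 // ltW.
have dxE : deltax p = mux p + a by [].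
have dyE : deltay p = muy p + b by [].
have a_ub : a <= Lx p / 16 by rewrite ler_pdivrMr //; lra.
have b_ub : b <= Ly p / 16 by rewrite ler_pdivrMr //; lra.
clearbody a b.
(* Each of the four terms of the expanded product is at most Lxy^2 / 324, using a Ly = muxy^2 and b
   Lx = muyx^2. *)
have dub : 9 * (deltax p * deltay p) <= Lxy p ^+ 2.
  rewrite dxE dyE.
  have h1 : mux p * b <= Lx p / 4 * b by rewrite ler_wpM2r //; lra.
  have h2 : a * muy p <= a * (Ly p / 4) by rewrite ler_wpM2l //; lra.
  have h3 : a * b <= Lx p / 16 * b by rewrite ler_wpM2r.
  have h4 : 324 * muxy p ^+ 2 <= Lxy p ^+ 2 by nra.
  have h5 : 324 * muyx p ^+ 2 <= Lxy p ^+ 2 by nra.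
  have h6 := sqr_ge0 (Lxy p); lra.
have dub' : 8 * (deltax p * deltay p) <= Lx p * Ly p.
  have dxu : deltax p <= 5 / 16 * Lx p by rewrite dxE; lra.
  have dyu : deltay p <= 5 / 16 * Ly p by rewrite dyE; lra.
  have := ler_pM (ltW dx0) (ltW dy0) dxu dyu.
  have := mulr_gt0 Lx0 Ly0; lra.
(* If [muyx] vanishes the one-sided instance applies; if only [muxy] does, it applies with the
   players exchanged. Otherwise both are equal, and the root of the determinant condition gives
   h. *)
have [muyx_gt0|muyx_le0] := ltP 0 (muyx p); last first.
  apply: coupling_ratio_onesided => //; last by lra.
  by apply/le_anti; rewrite muyx_le0.
have [muxy_gt0|muxy_le0] := ltP 0 (muxy p); last first.
  rewrite -(swap_paramsK p); apply: hard_ratio_swap => //.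
  rewrite [kappaxy _]kappaxy_swap.
  apply: coupling_ratio_onesided => //.
  - exact: admissible_swap.
  - by apply/le_anti; rewrite muxy_le0.
  - by rewrite /=; lra.
  - by rewrite [X in 9 * X]mulrC.
have muE := hmu muxy_gt0 muyx_gt0.
have [] := @determinant_root (Lx p) (Ly p) (mux p) (muy p) (muxy p) => //.
- by rewrite {2}muE; exact: mulr_gt0.
- by rewrite {2}muE.
move=> s; rewrite {2}muE -/(deltax p) -/(deltay p) => -[s0 s4 sE].
have h2 : Num.sqrt s ^+ 2 = s by rewrite sqr_sqrtr // ltW.
apply: (@coupling_ratio_of p (Num.sqrt s)) => //.
- by rewrite sqrtr_gt0.
- by rewrite h2.
- move=> m rho rho01 rhoE rho_exp.
  apply: (@coupling_instance_twosided _ _ m _ rho padm rho01 rhoE rho_exp dx0 dy0 s)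
    => //.
  + by lra.
  + by rewrite -[RHS]h2; congr (_ ^+ 2); field; rewrite gt_eqF.
  + by have := mulr_gt0 Lx0 Ly0; have := mulr_gt0 dx0 dy0; lra.
Qed.

End rates.

(** * Combination of the three oracle bounds *)

Unset Implicit Arguments.

Theorem theorem2 (R : realType) :
  exists c C : R, 0 < c /\ 0 < C /\
  forall p : params R,
    admissible p ->
    4 * mux p < Lx p ->
    4 * muy p < Ly p ->
    18 * Num.max (Num.max (muxy p) (muyx p)) (Num.sqrt (mux p * muy p)) < Lxy p ->
    4 * Num.max (muxy p) (muyx p) < Num.sqrt (Lx p * Ly p) ->
    0 < Num.min (deltax p) (deltay p) ->
  forall r eps tf tg tB : R,
    0 < r -> 0 < eps -> 0 < tf -> 0 < tg -> 0 < tB ->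
  exists (dx dy : nat) (f : 'cV[R]_dx -> R) (g : 'cV[R]_dy -> R)
         (B : 'M[R]_(dy, dx)),
    (0 < dx)%N /\ (0 < dy)%N /\
    regular p f g B /\
    R2 p f g B 0 0 = (r ^+ 2)%:E /\
    forall (Mx : R -> set 'cV[R]_dx) (My : R -> set 'cV[R]_dy)
           (xo : R -> 'cV[R]_dx) (yo : R -> 'cV[R]_dy),
      first_order_method f g B tf tg tB Mx My xo yo ->
      forall t : R, 0 <= t ->
        (R2 p f g B (xo t) (yo t) < eps%:E)%E ->
        C * (tf * Num.sqrt (kappax p) * ln (c * r ^+ 2 / eps) +
             tg * Num.sqrt (kappay p) * ln (c * r ^+ 2 / eps) +
             tB * Num.sqrt (kappaxy p) * ln (c * r ^+ 2 / eps)) <= t.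
Proof.
(* Here 72 = 3 x 24: each oracle gives its term divided by 24, and the largest term is at least a
   third of the sum. *)
exists (expR (- 8) / 3), (72^-1); split; first by rewrite divr_gt0 ?expR_gt0.
split; first by rewrite invr_gt0.
move=> p padm mux4 muy4 hL hLL; rewrite lt_min => /andP[dx0 dy0].
move=> r eps tf tg tB r0 e0 tf0 tg0 tB0.
have [/andP[mux0 hx] /andP[muy0 hy] /andP[muxy0 hxy] /andP[muyx0 _] _] := padm.
have LL0 : 0 <= Lx p * Ly p.
  by rewrite mulr_ge0 // ltW // (le_lt_trans _ hx, le_lt_trans _ hy).
have L0 : 0 < Lxy p := le_lt_trans muxy0 hxy.
have [m1 m2 m3] : [/\ 18 * muxy p <= Lxy p, 18 * muyx p <= Lxy p &
    18 * Num.sqrt (mux p * muy p) <= Lxy p].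
  move: hL; rewrite mulrC -ltr_pdivlMr // !gt_max => /andP[/andP[]].
  by rewrite !ltr_pdivlMr //; split; lra.
have m4 : 324 * (mux p * muy p) <= Lxy p ^+ 2.
  have := sqr_sqrtr (mulr_ge0 mux0 muy0); have := sqrtr_ge0 (mux p * muy p).
  by move: m3; set q := Num.sqrt _ => *; nra.
have [c1 c2] : 16 * muxy p ^+ 2 <= Lx p * Ly p /\ 16 * muyx p ^+ 2 <= Lx p * Ly p.
  move: hLL; rewrite mulrC -ltr_pdivlMr // gt_max !ltr_pdivlMr // => /andP[].
  have := sqr_sqrtr LL0; have := sqrtr_ge0 (Lx p * Ly p).
  by set q := Num.sqrt _ => *; split; nra.
set L := ln _; rewrite -/(hard p r eps tf tg tB _).
set X := tf * _ * L; set Y := tg * _ * L; set Z := tB * _ * L.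
have hX := gradient_ratio padm mux4 c1 dx0 dy0.
have hZ := coupling_ratio padm mux4 muy4 m1 m2 m4 c1 c2 dx0 dy0.
have hY : hard_ratio p false true false (kappay p).
  rewrite -(swap_paramsK p); apply: hard_ratio_swap => //.
  apply: (@gradient_ratio _ (swap_params p)) => //=.
    exact: admissible_swap.
  by rewrite [Ly p * _]mulrC.
have [XYZ|[XYZ|XYZ]] : 72^-1 * (X + Y + Z) <= X / 24 \/
    72^-1 * (X + Y + Z) <= Y / 24 \/ 72^-1 * (X + Y + Z) <= Z / 24.
- have [XY|XY] := leP X Y; have [YZ|YZ] := leP Y Z; have [XZ|XZ] := leP X Z;
    (left; lra) || (right; left; lra) || (right; right; lra).
- exact: (ratio_hard (tau := tf) hX).
- exact: (ratio_hard (tau := tg) hY).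
- exact: (ratio_hard (tau := tB) hZ).
Qed.
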